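(* For $\boldsymbol{x},\boldsymbol{y}\in\Gamma$, $\boldsymbol{x}\neq\boldsymbol{y}$, put $\boldsymbol{r}=\boldsymbol{x}-\boldsymbol{y}$ and $r=|\boldsymbol{x}-\boldsymbol{y}|$. The kernel $\mathbf{D}(\boldsymbol{x},\boldsymbol{y})=\left(\mathcal{T}_{\boldsymbol{y}}\mathbf{G}(\boldsymbol{x},\boldsymbol{y})\right)^\top$ of the elastic double layer boundary operator admits the decomposition $$\mathbf{D}(\boldsymbol{x},\boldsymbol{y})=\left(\mathcal{T}_{\boldsymbol{y}}\mathbf{E}(\boldsymbol{x},\boldsymbol{y})\right)^\top+\ln(r)\,\mathbf{F}_{\boldsymbol{y}}(\boldsymbol{x},\boldsymbol{y})+\boldsymbol{R}_{\mathbf{D}}(\boldsymbol{x},\boldsymbol{y}),$$ where $$\mathcal{T}_{\boldsymbol{y}}\mathbf{E}(\boldsymbol{x},\boldsymbol{y})=\frac{\boldsymbol{n}(\boldsymbol{y})\cdot\boldsymbol{r}}{2\pi r^2}\mathbf{I}-\frac{\mu}{\lambda+2\mu}\frac{\boldsymbol{\tau}(\boldsymbol{y})\cdot\boldsymbol{r}}{2\pi r^2}\mathbf{L}-\frac{\lambda+\mu}{\lambda+2\mu}\left(-\frac{(\boldsymbol{n}(\boldsymbol{y})\cdot\boldsymbol{r})\,\boldsymbol{r}\otimes\boldsymbol{r}}{\pi r^4}+\frac{\boldsymbol{n}(\boldsymbol{y})\cdot\boldsymbol{r}}{2\pi r^2}\mathbf{I}\right),$$ $$\mathbf{F}_{\boldsymbol{y}}(\boldsymbol{x},\boldsymbol{y})=-\frac{2}{\pi}\,\mathrm{Im}\left\{\left(\mathcal{T}_{\boldsymbol{y}}\mathbf{G}(\boldsymbol{x},\boldsymbol{y})\right)^\top\right\},$$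 and $\boldsymbol{R}_{\mathbf{D}}(\boldsymbol{x},\boldsymbol{y})\to0$ when $\boldsymbol{x}\to\boldsymbol{y}$. If the boundary $\Gamma$ is smooth, both $\mathbf{F}_{\boldsymbol{y}}(\boldsymbol{x},\boldsymbol{y})$ and the remainder term $\boldsymbol{R}_{\mathbf{D}}(\boldsymbol{x},\boldsymbol{y})$ are analytic on $\Gamma$.
   Context: Setting: $\lambda,\mu,\rho,\omega$ are real constants with $\mu>0$, $\lambda+\mu>0$, $\rho>0$, $\omega>0$; $k_{\mathfrak p}=\omega\sqrt{\rho/(\lambda+2\mu)}$ and $k_{\mathfrak s}=\omega\sqrt{\rho/\mu}$. $\Gamma\subset\mathbb{R}^2$ is the piecewise smooth boundary (with finitely many corners) of a domain $\Omega\subset\mathbb{R}^2$ such that either $\Omega$ or $\mathbb{R}^2\setminus\overline{\Omega}$ is bounded. On $\Gamma$ (away from corners), $\boldsymbol{n}=(n_1,n_2)^\top$ is the unit normal and $\boldsymbol{\tau}=(\tau_1,\tau_2)^\top=(-n_2,n_1)^\top$ the unit tangent. Green's functions, for $\boldsymbol{x}\ne\boldsymbol{y}$ and $r=|\boldsymbol{x}-\boldsymbol{y}|$: for the Navier equation $\mu\Delta\boldsymbol{u}+(\lambda+\mu)\nabla(\nabla\cdot\boldsymbol{u})+\rho\omega^2\boldsymbol{u}=0$, $$\mathbf{G}(\boldsymbol{x},\boldsymbol{y})=\frac{i}{4\mu}\left\{H_0^{(1)}(k_{\mathfrak s}r)\,\mathbf{I}+\frac{1}{k_{\mathfrak s}^2}\nabla_{\boldsymbol{x}}\nabla_{\boldsymbol{x}}^\top\left(H_0^{(1)}(k_{\mathfrak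 s}r)-H_0^{(1)}(k_{\mathfrak p}r)\right)\right\},$$ and for the Lamé system (the case $\omega=0$), $$\mathbf{E}(\boldsymbol{x},\boldsymbol{y})=\frac{\lambda+3\mu}{4\pi\mu(\lambda+2\mu)}\left\{-\ln|\boldsymbol{x}-\boldsymbol{y}|\,\mathbf{I}+\frac{\lambda+\mu}{\lambda+3\mu}\frac{1}{r^2}(\boldsymbol{x}-\boldsymbol{y})(\boldsymbol{x}-\boldsymbol{y})^\top\right\}.$$ Here $H_0^{(1)}$ is the Hankel function of the first kind of order zero and $\mathbf{I}$ is the $2\times2$ identity matrix. The traction operator is $\mathcal{T}\boldsymbol{u}=2\mu\frac{\partial\boldsymbol{u}}{\partial\boldsymbol{n}}+\lambda(\nabla\cdot\boldsymbol{u})\boldsymbol{n}-\mu\,\boldsymbol{\tau}\,\mathrm{curl}\,\boldsymbol{u}$, with $\mathrm{curl}\,\boldsymbol{u}=\partial_{x_1}u_2-\partial_{x_2}u_1$. $\mathcal{T}_{\boldsymbol{y}}$ denotes the traction operator acting on the variable $\boldsymbol{y}$ (with $\boldsymbol{n}=\boldsymbol{n}(\boldsymbol{y})$, $\boldsymbol{\tau}=\boldsymbol{\tau}(\boldsymbol{y})$), applied to a matrix column by column. Further, $\mathbf{L}=\begin{pmatrix}0&1\\-1&0\end{pmatrix}$, $\otimes$ is the outer product of two vectors ($\boldsymbol{a}\otimes\boldsymbol{b}=\boldsymbol{a}\boldsymbol{b}^\top$), and $\mathrm{Im}$ is the entrywise imaginary part.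
   Formalization: In the last sentence ''Γ smooth'' is taken as Γ real-analytic without corners: for a merely C^∞ Γ containing a straight segment the trace of F_y vanishes there but not on all of Γ, so it is not analytic on Γ. *)

(* Defs.v *)
From Stdlib Require Export Reals List Factorial.
From Coquelicot Require Export Coquelicot.
Open Scope R_scope.

(** * Vectors and 2x2 matrices, by components *)

Definition R2 : Type := (R * R)%type.

Inductive idx : Type := i1 | i2.

Definition idx_eqb (i j : idx) : bool :=
  match i, j with i1, i1 => true | i2, i2 => true | _, _ => false end.

Definition comp (v : R2) (i : idx) : R :=
  match i with i1 => fst v | i2 => snd v end.

Definition sub2 (x y : R2) : R2 := (fst x - fst y, snd x - snd y).
Definition dot2 (x y : R2) : R := fst x * fst y + snd x * snd y.
(* Euclidean length; the canonical norm of Coquelicot on [R * R] is not used. *)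
Definition len2 (x : R2) : R := sqrt (dot2 x x).

(* Unit tangent associated with the unit normal [n]. *)
Definition tangent (n : R2) : R2 := (- snd n, fst n).

Definition mxI (i j : idx) : R := if idx_eqb i j then 1 else 0.
Definition mxL (i j : idx) : R :=
  match i, j with i1, i2 => 1 | i2, i1 => -1 | _, _ => 0 end.
Definition outer (a b : R2) (i j : idx) : R := comp a i * comp b j.

(** * Differential operators on complex-valued functions on the plane *)

Definition CDerive (g : R -> C) (t : R) : C :=
  (Derive (fun s => Re (g s)) t, Derive (fun s => Im (g s)) t).

Definition partial (k : idx) (f : R2 -> C) (p : R2) : C :=
  match k with
  | i1 => CDerive (fun s => f (s, snd p)) (fst p)
  | i2 => CDerive (fun s => f (fst p, s)) (snd p)
  end.

Definition normal_deriv (n : R2) (f : R2 -> C) (p : R2) : C :=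
  (RtoC (fst n) * partial i1 f p + RtoC (snd n) * partial i2 f p)%C.

Definition divergence (u : R2 -> idx -> C) (p : R2) : C :=
  (partial i1 (fun q => u q i1) p + partial i2 (fun q => u q i2) p)%C.

Definition curl (u : R2 -> idx -> C) (p : R2) : C :=
  (partial i1 (fun q => u q i2) p - partial i2 (fun q => u q i1) p)%C.

Definition traction (lam mu : R) (n : R2) (u : R2 -> idx -> C) (p : R2)
    (i : idx) : C :=
  (RtoC (2 * mu) * normal_deriv n (fun q => u q i) p
   + RtoC lam * divergence u p * RtoC (comp n i)
   - RtoC mu * RtoC (comp (tangent n) i) * curl u p)%C.

(* Traction in the second variable, at [y] with normal [n], of every column
   of a matrix kernel [K x y]. *)
Definition traction_y (lam mu : R) (n : R2) (K : R2 -> R2 -> idx -> idx -> C)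
    (x y : R2) (i j : idx) : C :=
  traction lam mu n (fun z k => K x z k j) y i.

(** * The Hankel function of the first kind of order zero *)

Definition harmonic (m : nat) : R := sum_n_m (fun k => / INR k) 1 m.

Definition euler_gamma : R :=
  real (Lim_seq (fun m => harmonic m - ln (INR m))).

Definition bessel_J0 (z : R) : R :=
  PSeries (fun m => (-1) ^ m / (INR (fact m)) ^ 2) ((z / 2) ^ 2).

(* Y_0(z) = (2/pi) ((ln(z/2) + gamma) J_0(z)
                    - sum_m (-1)^m h_m (z/2)^(2m) / (m!)^2),   z > 0,
   where h_m is the m-th harmonic number. *)
Definition bessel_Y0 (z : R) : R :=
  2 / PI * ((ln (z / 2) + euler_gamma) * bessel_J0 z
    - PSeries (fun m => (-1) ^ m * harmonic m / (INR (fact m)) ^ 2)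
              ((z / 2) ^ 2)).

Definition hankel_H0 (z : R) : C :=
  (RtoC (bessel_J0 z) + Ci * RtoC (bessel_Y0 z))%C.

(** * Green's tensors *)

Definition wave_p (lam mu rho omega : R) : R :=
  omega * sqrt (rho / (lam + 2 * mu)).
Definition wave_s (mu rho omega : R) : R := omega * sqrt (rho / mu).

Definition green_navier (lam mu rho omega : R) (x y : R2) (i j : idx) : C :=
  let kp := wave_p lam mu rho omega in
  let ks := wave_s mu rho omega in
  (Ci / RtoC (4 * mu) *
   (hankel_H0 (ks * len2 (sub2 x y)) * RtoC (mxI i j)
    + RtoC (1 / ks ^ 2) *
      partial i
        (partial j (fun z => hankel_H0 (ks * len2 (sub2 z y))
                             - hankel_H0 (kp * len2 (sub2 z y)))) x))%C.

Definition green_lame (lam mu : R) (x y : R2) (i j : idx) : C :=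
  let r := sub2 x y in
  RtoC ((lam + 3 * mu) / (4 * PI * mu * (lam + 2 * mu)) *
        (- ln (len2 r) * mxI i j
         + (lam + mu) / (lam + 3 * mu) * (1 / len2 r ^ 2) * outer r r i j)).

(** * Domains with piecewise smooth boundary *)

Definition closure2 (A : R2 -> Prop) (x : R2) : Prop :=
  forall U : R2 -> Prop, locally x U -> exists y, U y /\ A y.
Definition complement (A : R2 -> Prop) (x : R2) : Prop := ~ A x.
Definition boundary (A : R2 -> Prop) (x : R2) : Prop :=
  closure2 A x /\ closure2 (complement A) x.
Definition bounded2 (A : R2 -> Prop) : Prop :=
  exists M : R, forall x, A x -> len2 x <= M.

Definition connected2 (A : R2 -> Prop) : Prop :=
  forall U V : R2 -> Prop, open U -> open V ->
    (forall x, A x -> U x \/ V x) ->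
    (exists x, A x /\ U x) -> (exists x, A x /\ V x) ->
    exists x, A x /\ U x /\ V x.

Definition is_domain (Omega : R2 -> Prop) : Prop :=
  open Omega /\ connected2 Omega /\ (exists x, Omega x).

(* [c] restricted to (-eps, eps) is a bijection onto a relatively open subset
   of [Gam] around [p = c 0]; the last clause says that this subset is
   relatively open and that the inverse of [c] is continuous. *)
Definition local_arc (Gam : R2 -> Prop) (p : R2) (c : R -> R2) (eps : R)
    : Prop :=
  0 < eps /\ c 0 = p /\
  (forall t, Rabs t < eps -> Gam (c t)) /\
  (forall s t, Rabs s < eps -> Rabs t < eps -> c s = c t -> s = t) /\
  (forall t0 delta, Rabs t0 < eps -> 0 < delta ->
     locally (c t0) (fun x => Gam x ->
       exists t, Rabs t < eps /\ Rabs (t - t0) < delta /\ x = c t)).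

Definition velocity (c : R -> R2) (t : R) : R2 :=
  (Derive (fun s => fst (c s)) t, Derive (fun s => snd (c s)) t).

Definition smooth_regular (c : R -> R2) (eps : R) : Prop :=
  forall t, Rabs t < eps ->
    (forall k, ex_derive_n (fun s => fst (c s)) k t
               /\ ex_derive_n (fun s => snd (c s)) k t)
    /\ velocity c t <> (0, 0).

Definition smooth_chart (Gam : R2 -> Prop) (p : R2) (c : R -> R2) : Prop :=
  exists eps, local_arc Gam p c eps /\ smooth_regular c eps.

(* Near a corner, [Gam] consists of two regular arcs, each smooth up to and
   including the corner. *)
Definition corner_point (Gam : R2 -> Prop) (p : R2) : Prop :=
  exists (eps : R) (cm cp : R -> R2),
    smooth_regular cm eps /\ smooth_regular cp eps /\ cm 0 = cp 0 /\
    local_arc Gam p (fun t => if Rlt_dec t 0 then cm t else cp t) eps.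

Definition piecewise_smooth (Gam : R2 -> Prop) (corners : list R2) : Prop :=
  (forall p, In p corners -> Gam p /\ corner_point Gam p) /\
  (forall p, Gam p -> ~ In p corners -> exists c, smooth_chart Gam p c).

(* The orientation (exterior or interior) of the normal is left open. *)
Definition unit_normal_field (Gam : R2 -> Prop) (corners : list R2)
    (n : R2 -> R2) : Prop :=
  forall y, Gam y -> ~ In y corners ->
    len2 (n y) = 1 /\
    (forall c, smooth_chart Gam y c -> dot2 (n y) (velocity c 0) = 0) /\
    filterlim n (within (fun x => Gam x /\ ~ In x corners) (locally y))
              (locally (n y)).

(** * Real analyticity *)

Definition analytic1 (f : R -> R) (t : R) : Prop :=
  exists a : nat -> R, Rbar_lt 0 (CV_radius a) /\
    locally 0 (fun h => f (t + h) = PSeries a h).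

(* Near (s, t), [f] is the sum of an absolutely convergent double power
   series. *)
Definition analytic2 (f : R -> R -> R) (s t : R) : Prop :=
  exists (a : nat -> nat -> R) (rad : R), 0 < rad /\
    (forall i, ex_series (fun j => Rabs (a i j) * rad ^ i * rad ^ j)) /\
    ex_series (fun i => Series (fun j => Rabs (a i j) * rad ^ i * rad ^ j)) /\
    (forall u v, Rabs u < rad -> Rabs v < rad ->
       f (s + u) (t + v) = Series (fun i => Series (fun j =>
                             a i j * u ^ i * v ^ j))).

Definition analytic_regular (c : R -> R2) (eps : R) : Prop :=
  forall t, Rabs t < eps ->
    analytic1 (fun s => fst (c s)) t /\ analytic1 (fun s => snd (c s)) t
    /\ velocity c t <> (0, 0).

(* A choice, for every point [p] of [Gam], of a regular analytic
   parametrization [chart p] of [Gam] near [p] with [chart p 0 = p]. *)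
Definition analytic_atlas (Gam : R2 -> Prop) (chart : R2 -> R -> R2) : Prop :=
  forall p, Gam p ->
    exists eps, local_arc Gam p (chart p) eps /\ analytic_regular (chart p) eps.

(* A kernel, given for x <> y only, is analytic on [Gam] when it extends to a
   jointly analytic function on [Gam] x [Gam], diagonal included. *)
Definition analytic_kernel (Gam : R2 -> Prop) (chart : R2 -> R -> R2)
    (f : R2 -> R2 -> R) : Prop :=
  exists g : R2 -> R2 -> R,
    (forall x y, Gam x -> Gam y -> x <> y -> g x y = f x y) /\
    (forall p q, Gam p -> Gam q ->
       analytic2 (fun s t => g (chart p s) (chart q t)) 0 0).

(** * The kernels *)

Definition traction_lame_formula (lam mu : R) (n x y : R2) (i j : idx) : R :=
  let rv := sub2 x y in
  let r := len2 rv in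
  dot2 n rv / (2 * PI * r ^ 2) * mxI i j
  - mu / (lam + 2 * mu) * (dot2 (tangent n) rv / (2 * PI * r ^ 2)) * mxL i j
  - (lam + mu) / (lam + 2 * mu) *
    (- (dot2 n rv * outer rv rv i j / (PI * r ^ 4))
     + dot2 n rv / (2 * PI * r ^ 2) * mxI i j).

Definition kernel_D (lam mu rho omega : R) (n : R2 -> R2) (x y : R2)
    (i j : idx) : C :=
  traction_y lam mu (n y) (green_navier lam mu rho omega) x y j i.

Definition kernel_F (lam mu rho omega : R) (n : R2 -> R2) (x y : R2)
    (i j : idx) : R :=
  - (2 / PI) *
  Im (traction_y lam mu (n y) (green_navier lam mu rho omega) x y j i).

(* Main.v *)
(** H_0^(1)(k r) is a(r^2) + i (2/pi) (ln(r) a(r^2) + b(r^2)) with a, b entire, so each Green tensor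
    has the form al(|r|^2) I + be(|r|^2) r r^T, and its traction is a linear form in the values of
    al', be, be' at |r|^2.  By this linearity the logarithmic part of the traction of G is
    -(2/pi) ln(r) times its imaginary part.  As J_0(ks r) - J_0(kp r) vanishes to second order, what
    is left is the traction of the Lame tensor plus a remainder whose coefficients are entire in
    |r|^2, except for one of the form c(|r|^2) r_i r_j r_k / |r|^2.  On an analytic arc
    r = (s - t) D with D analytic and nonzero, so that term is analytic as well; so is the unit
    normal, the velocity turned by a right angle and normalized, with a locally constant sign. *)

From Stdlib Require Import Reals List Lra Lia Psatz.
From Stdlib Require Ranalysis5.
From Coquelicot Require Import Coquelicot.
(* Last, because [Reals] has another [comp]. *)
Require Import Defs.
Open Scope R_scope.

(** Analyticity is demanded jointly in two variables, diagonal included, so functions on charts are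
    treated as germs given by double power series. Coefficient families are measured in two ways: by
    a weighted supremum, which is easy to check, and by a weighted l1 norm, which is
    submultiplicative under Cauchy products and so controls powers and compositions. Halving the
    radius leads from the first to the second.

    The [1/r] singularities of the two tractions match because kp^2 (lam + 2 mu) = ks^2 mu, which
    turns the coefficient (kp^2 - ks^2)/4 of the Hessian term into the Lame constants.

    The Lame term and the logarithmic term are real, so the remainder carries the whole imaginary
    part of the traction of G. Hence F is a constant multiple of the imaginary part of the
    remainder, and all analyticity claims reduce to one statement about the remainder. There the
    quotient by |r|^2 is always multiplied by components of r, so the formula has the value 0 on the
    diagonal and is its own analytic extension. *)

(** * Bounds for series and power series in one variable *)

Lemma abs_series_bound (x : nat -> R) (M : R) :
  (forall n, sum_f_R0 (fun k => Rabs (x k)) n <= M) ->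
  ex_series (fun k => Rabs (x k)) /\ Rabs (Series x) <= M.
Proof.
  intros H.
  assert (Hex : ex_series (fun k => Rabs (x k))).
  { destruct (ex_finite_lim_seq_incr (sum_n (fun k => Rabs (x k))) M) as [l Hl].
    - intros n. rewrite sum_Sn. pose proof (Rabs_pos (x (S n))).
      unfold plus; simpl. lra.
    - intros n. rewrite sum_n_Reals. apply H.
    - exists l. exact Hl. }
  split; [exact Hex|].
  eapply Rle_trans; [apply Series_Rabs; exact Hex|].
  assert (L : is_lim_seq (sum_n (fun k => Rabs (x k))) (Series (fun k => Rabs (x k))))
    by exact (Series_correct _ Hex).
  apply (is_lim_seq_le _ (fun _ => M) _ M) in L; [exact L| |apply is_lim_seq_const].
  intros n. rewrite sum_n_Reals. apply H.
Qed.

Lemma ex_series_Rabs_le (a b : nat -> R) :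
  (forall n, Rabs (a n) <= b n) -> ex_series b -> ex_series (fun n => Rabs (a n)).
Proof.
  intros H Hb. apply (@ex_series_le R_AbsRing R_CompleteNormedModule _ b); [|exact Hb].
  intros n. unfold norm; simpl; unfold abs; simpl. now rewrite Rabs_Rabsolu.
Qed.

Lemma ex_series_Rmult_l (c : R) (a : nat -> R) :
  ex_series a -> ex_series (fun n => c * a n).
Proof. exact (@ex_series_scal_l R_AbsRing R_NormedModule c a). Qed.

Lemma half_geom_sum (n : nat) : sum_f_R0 (fun k => (/ 2) ^ k) n <= 2.
Proof.
  assert (H : sum_f_R0 (fun k => (/ 2) ^ k) n = 2 - (/ 2) ^ n).
  { induction n as [|n IH]; [simpl; lra|]. rewrite tech5, IH; simpl; field. }
  rewrite H. assert (0 < (/ 2) ^ n) by (apply pow_lt; lra). lra.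
Qed.

Lemma sum_f_R0_scal (x : nat -> R) (c : R) (n : nat) :
  sum_f_R0 (fun k => c * x k) n = c * sum_f_R0 x n.
Proof. induction n as [|n IH]; simpl; [|rewrite IH]; ring. Qed.

Lemma sum_f_R0_nonneg (x : nat -> R) (n : nat) :
  (forall k, 0 <= x k) -> 0 <= sum_f_R0 x n.
Proof. intros H; induction n as [|n IH]; simpl; [apply H|]. specialize (H (S n)); lra. Qed.

Lemma sum_f_R0_term (x : nat -> R) (n k : nat) :
  (forall k, 0 <= x k) -> (k <= n)%nat -> x k <= sum_f_R0 x n.
Proof.
  intros H; induction n as [|n IH]; intros Hk.
  - replace k with 0%nat by lia. simpl; lra.
  - simpl. destruct (Nat.eq_dec k (S n)) as [->|Hne].
    + pose proof (sum_f_R0_nonneg x n H). lra.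
    + specialize (IH ltac:(lia)). specialize (H (S n)). lra.
Qed.

Lemma pow_half (v r : R) (k : nat) : 0 < r -> Rabs v <= r / 2 -> Rabs (v ^ k) <= r ^ k * (/ 2) ^ k.
Proof.
  intros Hr Hv. rewrite <- RPow_abs, <- Rpow_mult_distr.
  apply pow_incr. split; [apply Rabs_pos|]. lra.
Qed.

(** At half the radius the terms are at most [M] 2^-k; the factor 2 is the sum of the geometric
    series. *)
Lemma half_radius_sum (a : nat -> R) (r M v : R) (n : nat) :
  0 < r -> Rabs v <= r / 2 -> (forall k, Rabs (a k) * r ^ k <= M) ->
  sum_f_R0 (fun k => Rabs (a k * v ^ k)) n <= 2 * M.
Proof.
  intros Hr Hv Ha.
  assert (HM : 0 <= M).
  { specialize (Ha 0%nat). simpl in Ha. pose proof (Rabs_pos (a 0%nat)). lra. }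
  apply Rle_trans with (sum_f_R0 (fun k => M * (/ 2) ^ k) n).
  - apply sum_Rle. intros k _. rewrite Rabs_mult.
    apply Rle_trans with (Rabs (a k) * (r ^ k * (/ 2) ^ k)).
    + apply Rmult_le_compat_l; [apply Rabs_pos|]. now apply pow_half.
    + rewrite <- Rmult_assoc. apply Rmult_le_compat_r; [|apply Ha].
      apply pow_le; lra.
  - rewrite sum_f_R0_scal, (Rmult_comm 2). apply Rmult_le_compat_l; [exact HM|apply half_geom_sum].
Qed.

Lemma CV_radius_lower (a : nat -> R) (r M v : R) :
  0 < r -> Rabs v < r -> (forall k, Rabs (a k) * r ^ k <= M) ->
  Rbar_lt (Rabs v) (CV_radius a).
Proof.
  intros Hr Hv Ha. apply Rbar_lt_le_trans with r; [exact Hv|].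
  apply (proj1 (CV_radius_bounded a)). exists M. intros k.
  rewrite Rabs_mult, (Rabs_pos_eq (r ^ k)); [apply Ha|]. apply pow_le; lra.
Qed.

(** The terms of a series converging at [r] tend to zero, hence are bounded. Any [r] inside the disk
    serves: half the radius, or 1 if the radius is infinite. *)
Lemma CV_radius_bound (a : nat -> R) :
  Rbar_lt 0 (CV_radius a) ->
  exists r M, 0 < r /\ forall k, Rabs (a k) * r ^ k <= M.
Proof.
  intros H.
  assert (Hr : exists r, 0 < r /\ Rbar_lt (Rabs r) (CV_radius a)).
  { destruct (CV_radius a) as [c| |]; simpl in *.
    - exists (c / 2). rewrite Rabs_pos_eq; lra.
    - exists 1. split; [lra|exact I].
    - contradiction. }
  destruct Hr as [r [Hr Hc]]. exists r.
  pose proof (ex_series_lim_0 _ (CV_disk_inside _ _ Hc)) as L.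
  destruct (filterlim_bounded (fun n => Rabs (a n * r ^ n))) as [M HM].
  { exists 0. exact L. }
  exists M. split; [exact Hr|]. intros k. specialize (HM k).
  unfold norm in HM; simpl in HM; unfold abs in HM; simpl in HM.
  rewrite Rabs_Rabsolu, Rabs_mult, (Rabs_pos_eq (r ^ k)) in HM; [exact HM|].
  apply pow_le; lra.
Qed.

(** * Double power series *)

Definition PS2 (a : nat -> nat -> R) (u v : R) : R :=
  PSeries (fun i => PSeries (a i) v) u.

Definition dominated (a : nat -> nat -> R) (r M : R) : Prop :=
  forall i j, Rabs (a i j) * r ^ j * r ^ i <= M.

(** Square partial sums of a weighted l1 norm. Unlike the supremum bound [dominated], this norm is
    submultiplicative for the Cauchy product ([l1sum_mult]), so the m-th power of a series is
    bounded by the m-th power of its bound. *)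
Definition l1sum (r : R) (a : nat -> nat -> R) (n : nat) : R :=
  sum_f_R0 (fun i => sum_f_R0 (fun j => Rabs (a i j) * r ^ j) n * r ^ i) n.

Lemma l1sum_dominated (r M : R) (a : nat -> nat -> R) :
  0 < r -> (forall n, l1sum r a n <= M) -> dominated a r M.
Proof.
  intros Hr H i j. eapply Rle_trans; [|apply (H (max i j))].
  unfold l1sum.
  assert (P : forall k, 0 <= r ^ k) by (intros; apply pow_le; lra).
  assert (P2 : forall k l, 0 <= Rabs (a k l) * r ^ l)
    by (intros; apply Rmult_le_pos; [apply Rabs_pos|apply P]).
  eapply Rle_trans; [|apply (sum_f_R0_term _ _ i)].
  - apply Rmult_le_compat_r; [apply P|].
    apply (sum_f_R0_term (fun j => Rabs (a i j) * r ^ j)); [apply P2|lia].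
  - intros k. apply Rmult_le_pos; [|apply P]. now apply sum_f_R0_nonneg.
  - lia.
Qed.

Lemma dominated_le (a : nat -> nat -> R) (r r' M : R) :
  0 < r' <= r -> dominated a r M -> dominated a r' M.
Proof.
  intros Hr H i j. eapply Rle_trans; [|apply (H i j)].
  rewrite !Rmult_assoc. apply Rmult_le_compat_l; [apply Rabs_pos|].
  apply Rmult_le_compat; try (apply pow_le; lra); apply pow_incr; lra.
Qed.

Lemma dominated_nonneg (a : nat -> nat -> R) (r M : R) : dominated a r M -> 0 <= M.
Proof. intros H. specialize (H 0 0)%nat. simpl in H. pose proof (Rabs_pos (a 0 0)%nat). lra. Qed.

Lemma pow_half_eq (r : R) (k : nat) : (r / 2) ^ k = r ^ k * (/ 2) ^ k.
Proof. unfold Rdiv. apply Rpow_mult_distr. Qed.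

(** At half the radius the term of index (i, j) gains the factor 2^-(i+j), and these factors sum to
    at most 4. *)
Lemma dominated_l1sum (a : nat -> nat -> R) (r M : R) :
  0 < r -> dominated a r M -> forall n, l1sum (r / 2) a n <= 4 * M.
Proof.
  intros Hr H n. pose proof (dominated_nonneg _ _ _ H) as HM. unfold l1sum.
  apply Rle_trans with (sum_f_R0 (fun i => 2 * M * (/ 2) ^ i) n).
  - apply sum_Rle. intros i _.
    apply Rle_trans with (sum_f_R0 (fun j => M * / r ^ i * (/ 2) ^ j) n * (r / 2) ^ i).
    + apply Rmult_le_compat_r; [apply pow_le; lra|].
      apply sum_Rle. intros j _. rewrite pow_half_eq, <- Rmult_assoc.
      apply Rmult_le_compat_r; [apply pow_le; lra|].
      apply Rmult_le_reg_r with (r ^ i); [apply pow_lt; lra|].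
      rewrite (Rmult_assoc M), Rinv_l; [rewrite Rmult_1_r; apply H|].
      apply Rgt_not_eq, pow_lt; lra.
    + rewrite sum_f_R0_scal, pow_half_eq.
      pose proof (half_geom_sum n). assert (0 < r ^ i) by (apply pow_lt; lra).
      assert (0 < (/ 2) ^ i) by (apply pow_lt; lra).
      apply Rle_trans with (M * / r ^ i * 2 * (r ^ i * (/ 2) ^ i)).
      * apply Rmult_le_compat_r; [apply Rmult_le_pos; lra|].
        apply Rmult_le_compat_l; [|apply half_geom_sum].
        apply Rmult_le_pos; [lra|]. left; now apply Rinv_0_lt_compat.
      * right. field. lra.
  - rewrite sum_f_R0_scal. apply Rle_trans with (2 * M * 2); [|lra].
    apply Rmult_le_compat_l; [lra|apply half_geom_sum].
Qed.

Lemma dominated_inner (a : nat -> nat -> R) (r M : R) (i : nat) :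
  0 < r -> dominated a r M -> forall k, Rabs (a i k) * r ^ k <= M / r ^ i.
Proof.
  intros Hr H k. assert (0 < r ^ i) by (apply pow_lt; lra).
  apply Rmult_le_reg_r with (r ^ i); [lra|].
  replace (M / r ^ i * r ^ i) with M by (field; lra). apply H.
Qed.

Lemma inner_CV (a : nat -> nat -> R) (r M v : R) (i : nat) :
  0 < r -> dominated a r M -> Rabs v < r -> Rbar_lt (Rabs v) (CV_radius (a i)).
Proof.
  intros Hr H Hv. apply (CV_radius_lower _ r (M / r ^ i)); try easy.
  now apply dominated_inner.
Qed.

Lemma inner_bound (a : nat -> nat -> R) (r M v : R) (i : nat) :
  0 < r -> dominated a r M -> Rabs v <= r / 2 ->
  Rabs (PSeries (a i) v) * r ^ i <= 2 * M.
Proof.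
  intros Hr H Hv. assert (0 < r ^ i) by (apply pow_lt; lra).
  assert (Rabs (PSeries (a i) v) <= 2 * (M / r ^ i)).
  { apply abs_series_bound. intros n. apply half_radius_sum with r; try easy.
    now apply dominated_inner. }
  replace (2 * M) with (2 * (M / r ^ i) * r ^ i) by (field; lra).
  apply Rmult_le_compat_r; lra.
Qed.

Lemma outer_CV (a : nat -> nat -> R) (r M u v : R) :
  0 < r -> dominated a r M -> Rabs u < r -> Rabs v <= r / 2 ->
  Rbar_lt (Rabs u) (CV_radius (fun i => PSeries (a i) v)).
Proof.
  intros Hr H Hu Hv. apply (CV_radius_lower _ r (2 * M)); try easy.
  intros k. now apply inner_bound.
Qed.

Lemma PS2_bound (a : nat -> nat -> R) (r M u v : R) :
  0 < r -> dominated a r M -> Rabs u <= r / 2 -> Rabs v <= r / 2 ->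
  Rabs (PS2 a u v) <= 4 * M.
Proof.
  intros Hr H Hu Hv. replace (4 * M) with (2 * (2 * M)) by ring.
  apply abs_series_bound. intros n. apply half_radius_sum with r; try easy.
  intros k. now apply inner_bound.
Qed.

Lemma PSeries_ext_finite0 (a : nat -> R) (x : R) :
  (forall k, a (S k) = 0) -> PSeries a x = a 0%nat.
Proof.
  intros H. unfold PSeries.
  assert (E : forall k, a (S k) * x ^ S k = 0) by (intros; rewrite H; ring).
  assert (Hz : ex_series (fun k => a (S k) * x ^ S k)).
  { apply ex_series_ext with (fun _ => 0); [intros; now rewrite E|].
    exists 0. apply filterlim_ext with (fun _ => 0); [|apply filterlim_const].
    intros n. rewrite sum_n_Reals. induction n; simpl; lra. }
  rewrite Series_incr_1; [|apply ex_series_incr_1; exact Hz].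
  rewrite (Series_ext _ (fun _ => 0 * 0)); [|intros; rewrite E; ring].
  rewrite Series_scal_l. simpl; ring.
Qed.

Lemma PS2_00 (a : nat -> nat -> R) : PS2 a 0 0 = a 0%nat 0%nat.
Proof. unfold PS2. rewrite PSeries_0. apply PSeries_0. Qed.

Lemma PS2_row (a : nat -> R) (u v : R) :
  PS2 (fun i j => match i with O => a j | _ => 0 end) u v = PSeries a v.
Proof.
  unfold PS2. rewrite PSeries_ext_finite0; [reflexivity|]. intros k. apply PSeries_const_0.
Qed.

Lemma PS2_col (a : nat -> R) (u v : R) :
  PS2 (fun i j => match j with O => a i | _ => 0 end) u v = PSeries a u.
Proof. unfold PS2. apply PSeries_ext. intros i. now rewrite PSeries_ext_finite0. Qed.

Lemma PS2_plus (a b : nat -> nat -> R) (r M N u v : R) :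
  0 < r -> dominated a r M -> dominated b r N -> Rabs u <= r / 2 -> Rabs v <= r / 2 ->
  PS2 (fun i j => a i j + b i j) u v = PS2 a u v + PS2 b u v.
Proof.
  intros Hr Ha Hb Hu Hv. unfold PS2.
  assert (I : forall c K i, dominated c r K -> ex_pseries (c i) v).
  { intros c K i Hc. apply CV_radius_inside, (inner_CV c r K); trivial; lra. }
  rewrite <- PSeries_plus.
  - apply PSeries_ext. intros i. change plus with Rplus. unfold PS_plus.
    change plus with Rplus. rewrite <- PSeries_plus; eauto.
  - apply CV_radius_inside, (outer_CV a r M); trivial; lra.
  - apply CV_radius_inside, (outer_CV b r N); trivial; lra.
Qed.

Definition PS2_mult (a b : nat -> nat -> R) (i j : nat) : R :=
  sum_f_R0 (fun k => PS_mult (a k) (b (i - k)%nat) j) i.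

Lemma PSeries_sum (F : nat -> nat -> R) (v : R) (n : nat) :
  (forall k, ex_pseries (F k) v) ->
  ex_pseries (fun j => sum_f_R0 (fun k => F k j) n) v /\
  PSeries (fun j => sum_f_R0 (fun k => F k j) n) v = sum_f_R0 (fun k => PSeries (F k) v) n.
Proof.
  intros H. induction n as [|n [IH1 IH2]]; simpl.
  - split; [apply H|reflexivity].
  - split.
    + apply (ex_pseries_plus (fun j => sum_f_R0 (fun k => F k j) n) (F (S n))); auto.
    + rewrite <- IH2.
      rewrite <- (PSeries_plus (fun j => sum_f_R0 (fun k => F k j) n) (F (S n))); auto.
Qed.

Lemma PS2_mult_val (a b : nat -> nat -> R) (r M N u v : R) :
  0 < r -> dominated a r M -> dominated b r N -> Rabs u <= r / 2 -> Rabs v <= r / 2 ->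
  PS2 (PS2_mult a b) u v = PS2 a u v * PS2 b u v.
Proof.
  intros Hr Ha Hb Hu Hv. unfold PS2.
  rewrite <- PSeries_mult; [|apply (outer_CV a r M); trivial; lra
                            |apply (outer_CV b r N); trivial; lra].
  apply PSeries_ext. intros i. unfold PS2_mult.
  assert (Ia : forall k, Rbar_lt (Rabs v) (CV_radius (a k)))
    by (intros; apply (inner_CV a r M); trivial; lra).
  assert (Ib : forall k, Rbar_lt (Rabs v) (CV_radius (b k)))
    by (intros; apply (inner_CV b r N); trivial; lra).
  rewrite (proj2 (PSeries_sum (fun k => PS_mult (a k) (b (i - k)%nat)) v i
     (fun k => ex_pseries_mult _ _ _ (Ia k) (Ib _)))).
  apply sum_eq. intros k _. now apply PSeries_mult.
Qed.

(** The left side sums nonnegative products over the triangle of index pairs with total at most [n],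
    the right side over the full square. *)
Lemma cauchy_sum_le (x y : nat -> R) (n : nat) :
  (forall k, 0 <= x k) -> (forall k, 0 <= y k) ->
  sum_f_R0 (fun i => sum_f_R0 (fun k => x k * y (i - k)%nat) i) n
  <= sum_f_R0 x n * sum_f_R0 y n.
Proof.
  intros Hx Hy.
  assert (E : sum_f_R0 (fun i => sum_f_R0 (fun k => x k * y (i - k)%nat) i) n
              = sum_f_R0 (fun k => x k * sum_f_R0 y (n - k)) n).
  { induction n as [|n IH]; [reflexivity|].
    rewrite (tech5 (fun i => sum_f_R0 _ i)), IH.
    rewrite (tech5 (fun k => x k * sum_f_R0 y (S n - k))), (tech5 _ n).
    replace (S n - S n)%nat with 0%nat by lia.
    rewrite <- Rplus_assoc, <- plus_sum. f_equal.
    apply sum_eq. intros k Hk. replace (S n - k)%nat with (S (n - k)) by lia.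
    simpl. ring. }
  rewrite E, (Rmult_comm (sum_f_R0 x n)), <- sum_f_R0_scal.
  apply sum_Rle. intros k Hk. rewrite Rmult_comm.
  apply Rmult_le_compat_r; [apply Hx|].
  destruct (Nat.eq_dec k 0) as [->|Hk0]; [rewrite Nat.sub_0_r; lra|].
  rewrite (tech2 y (n - k) n) by lia.
  pose proof (sum_f_R0_nonneg (fun i => y (S (n - k) + i)%nat) (n - S (n - k))
    (fun i => Hy _)). lra.
Qed.

(** The triangle inequality followed by [cauchy_sum_le] in each index: in the second index for each
    pair of rows, then in the first for the row sums. The weights split along the convolution, r^i =
    r^k r^(i-k). *)
Lemma l1sum_mult (a b : nat -> nat -> R) (r : R) (n : nat) :
  0 < r -> l1sum r (PS2_mult a b) n <= l1sum r a n * l1sum r b n.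
Proof.
  intros Hr. unfold l1sum.
  assert (P : forall k, 0 <= r ^ k) by (intros; apply pow_le; lra).
  set (row := fun (c : nat -> nat -> R) i => sum_f_R0 (fun j => Rabs (c i j) * r ^ j) n).
  assert (Prow : forall c i, 0 <= row c i).
  { intros. apply sum_f_R0_nonneg. intros. apply Rmult_le_pos; [apply Rabs_pos|apply P]. }
  eapply Rle_trans; [|apply (cauchy_sum_le (fun i => row a i * r ^ i) (fun i => row b i * r ^ i));
     intros; apply Rmult_le_pos; auto].
  apply sum_Rle. intros i _.
  assert (E : forall k, (k <= i)%nat -> row a k * r ^ k * (row b (i - k)%nat * r ^ (i - k))
                = r ^ i * (row a k * row b (i - k)%nat)).
  { intros k Hk. replace i with (k + (i - k))%nat at 3 by lia. rewrite pow_add. ring. }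
  rewrite (sum_eq _ _ i E), sum_f_R0_scal, Rmult_comm.
  apply Rmult_le_compat_l; [apply P|].
  apply Rle_trans with
    (sum_f_R0 (fun k => sum_f_R0 (fun j => sum_f_R0 (fun l =>
        (Rabs (a k l) * r ^ l) * (Rabs (b (i - k)%nat (j - l)%nat) * r ^ (j - l))) j) n) i).
  - assert (Sw : forall F : nat -> nat -> R, forall p q,
      sum_f_R0 (fun k => sum_f_R0 (fun j => F k j) q) p
      = sum_f_R0 (fun j => sum_f_R0 (fun k => F k j) p) q).
    { intros F p q. induction p as [|p IH]; [reflexivity|].
      simpl. rewrite IH, <- plus_sum. reflexivity. }
    rewrite Sw. apply sum_Rle. intros j _. unfold PS2_mult.
    eapply Rle_trans; [apply Rmult_le_compat_r; [apply P|apply Rabs_triang_gen]|].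
    rewrite Rmult_comm, <- sum_f_R0_scal. apply sum_Rle. intros k _.
    unfold PS_mult.
    eapply Rle_trans; [apply Rmult_le_compat_l; [apply P|apply Rabs_triang_gen]|].
    rewrite <- sum_f_R0_scal. right. apply sum_eq. intros l Hl.
    rewrite Rabs_mult. replace j with (l + (j - l))%nat at 1 by lia.
    rewrite pow_add. ring.
  - apply sum_Rle. intros k _. unfold row.
    apply (cauchy_sum_le (fun l => Rabs (a k l) * r ^ l)
       (fun l => Rabs (b (i - k)%nat l) * r ^ l));
    intros; apply Rmult_le_pos; auto; apply Rabs_pos.
Qed.

Lemma l1sum_nonneg (r : R) (a : nat -> nat -> R) (n : nat) : 0 < r -> 0 <= l1sum r a n.
Proof.
  intros Hr. unfold l1sum. apply sum_f_R0_nonneg. intros i.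
  apply Rmult_le_pos; [|apply pow_le; lra].
  apply sum_f_R0_nonneg. intros j. apply Rmult_le_pos; [apply Rabs_pos|apply pow_le; lra].
Qed.

Fixpoint PS2_pow (a : nat -> nat -> R) (m : nat) : nat -> nat -> R :=
  match m with
  | O => fun i j => match i, j with O, O => 1 | _, _ => 0 end
  | S m => PS2_mult a (PS2_pow a m)
  end.

Lemma l1sum_pow (a : nat -> nat -> R) (r M : R) (m : nat) :
  0 < r -> (forall n, l1sum r a n <= M) -> forall n, l1sum r (PS2_pow a m) n <= M ^ m.
Proof.
  intros Hr Ha. induction m as [|m IH]; intros n.
  - simpl. unfold l1sum.
    assert (R0 : forall i n, sum_f_R0 (fun j => Rabs (PS2_pow a 0 i j) * r ^ j) n
                 = match i with O => 1 | _ => 0 end).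
    { intros i p. induction p as [|p IHp].
      - simpl. destruct i; rewrite ?Rabs_R1, ?Rabs_R0; ring.
      - rewrite tech5, IHp. simpl. destruct i; rewrite Rabs_R0; ring. }
    rewrite (sum_eq _ (fun i => match i with O => 1 | _ => 0 end)).
    + right. clear. induction n as [|n IH]; [reflexivity|]. rewrite tech5, IH. ring.
    + intros i _. simpl in R0. rewrite R0. destruct i; simpl; ring.
  - simpl. eapply Rle_trans; [now apply l1sum_mult|].
    apply Rmult_le_compat; auto using l1sum_nonneg.
Qed.

Lemma PS2_pow_val (a : nat -> nat -> R) (r M u v : R) (m : nat) :
  0 < r -> (forall n, l1sum r a n <= M) -> Rabs u <= r / 2 -> Rabs v <= r / 2 ->
  PS2 (PS2_pow a m) u v = PS2 a u v ^ m.
Proof.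
  intros Hr Ha Hu Hv. induction m as [|m IH].
  - unfold PS2. rewrite (PSeries_ext_finite0 (fun i => PSeries (PS2_pow a 0 i) v)).
    + now rewrite PSeries_ext_finite0.
    + intros k. apply PSeries_const_0.
  - simpl. rewrite (PS2_mult_val _ _ r M (M ^ m)); trivial.
    + now rewrite IH.
    + now apply l1sum_dominated.
    + apply l1sum_dominated; trivial. now apply l1sum_pow.
Qed.

Lemma Series_sum (F : nat -> nat -> R) (n : nat) :
  (forall k, ex_series (F k)) ->
  ex_series (fun j => sum_f_R0 (fun k => F k j) n) /\
  Series (fun j => sum_f_R0 (fun k => F k j) n) = sum_f_R0 (fun k => Series (F k)) n.
Proof.
  intros H. induction n as [|n [IH1 IH2]]; simpl.
  - split; [apply H|reflexivity].
  - split.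
    + apply (ex_series_plus (fun j => sum_f_R0 (fun k => F k j) n) (F (S n))); auto.
    + rewrite <- IH2.
      rewrite <- (Series_plus (fun j => sum_f_R0 (fun k => F k j) n) (F (S n))); auto.
Qed.

(** Fubini under a product majorant. A finite sum over [m] up to [N] may be exchanged with the
    series over [i]; what is left of column [i] is at most the tail of [al] times [be i], so the
    total error is at most this tail times the sum of [be]. *)
Lemma Series_swap (x : nat -> nat -> R) (al be : nat -> R) :
  (forall m i, Rabs (x m i) <= al m * be i) -> (forall m, 0 <= al m) -> (forall i, 0 <= be i) ->
  ex_series al -> ex_series be ->
  Series (fun m => Series (fun i => x m i)) = Series (fun i => Series (fun m => x m i)).
Proof.
  intros Hx Hal Hbe Sal Sbe.
  assert (ExA : forall m, ex_series (fun i => Rabs (x m i))).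
  { intros m. apply (ex_series_Rabs_le _ (fun i => al m * be i)).
    - intros i.  apply Hx.
    - now apply ex_series_Rmult_l. }
  assert (Ex1 : forall m, ex_series (x m)) by (intros; now apply ex_series_Rabs).
  assert (ExB : forall i, ex_series (fun m => Rabs (x m i))).
  { intros i. apply (ex_series_Rabs_le _ (fun m => al m * be i)).
    - intros m.  apply Hx.
    - now apply ex_series_scal_r. }
  assert (Ex2 : forall i, ex_series (fun m => x m i)) by (intros; now apply ex_series_Rabs).
  assert (Bd : forall i, Rabs (Series (fun m => x m i)) <= Series al * be i).
  { intros i. eapply Rle_trans; [apply Series_Rabs, ExB|].
    rewrite <- Series_scal_r. apply Series_le; [|now apply ex_series_scal_r].
    intros m. split; [apply Rabs_pos|apply Hx]. }
  assert (ExC : ex_series (fun i => Series (fun m => x m i))).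
  { apply ex_series_Rabs, (ex_series_Rabs_le _ (fun i => Series al * be i)).
    - intros i.  apply Bd.
    - now apply ex_series_Rmult_l. }
  apply is_series_unique.
  change (is_lim_seq (sum_n (fun m => Series (x m)))
            (Series (fun i => Series (fun m => x m i)))).
  apply is_lim_seq_ext with (fun N => sum_f_R0 (fun m => Series (x m)) N).
  { intros N. now rewrite sum_n_Reals. }
  assert (T : is_lim_seq (fun N => (Series al - sum_n al N) * Series be) 0).
  { replace 0 with ((Series al - Series al) * Series be) by ring.
    apply is_lim_seq_mult'; [|apply is_lim_seq_const].
    apply is_lim_seq_minus'; [apply is_lim_seq_const|]. exact (Series_correct _ Sal). }
  apply is_lim_seq_ext with (fun N => Series (fun i => Series (fun m => x m i)) -
    (Series (fun i => Series (fun m => x m i)) - sum_f_R0 (fun m => Series (x m)) N));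
    [intros; ring|].
  rewrite <- (Rminus_0_r (Series (fun i => Series (fun m => x m i)))) at 1.
  apply is_lim_seq_minus'; [apply is_lim_seq_const|].
  apply is_lim_seq_abs_0.
  apply is_lim_seq_le_le with (fun _ => 0) (fun N => (Series al - sum_n al N) * Series be);
    [|apply is_lim_seq_const|exact T].
  intros N. split; [apply Rabs_pos|].
  rewrite <- (proj2 (Series_sum x N Ex1)), <- Series_minus; [|easy|apply Series_sum; easy].
  assert (B : forall i, Rabs (Series (fun m => x m i) - sum_f_R0 (fun k => x k i) N)
     <= (Series al - sum_n al N) * be i).
  { intros i. rewrite (Series_incr_n (fun m => x m i) (S N)) by (easy || lia).
    rewrite (Series_incr_n al (S N)) by (easy || lia). simpl pred.
    rewrite sum_n_Reals.
    match goal with |- Rabs (?p + ?q - _) <= _ => replace (p + q - p) with q by ring end.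
    replace (sum_f_R0 al N + Series (fun k => al (S N + k)%nat) - sum_f_R0 al N)
      with (Series (fun k => al (S N + k)%nat)) by ring.
    assert (E1 : ex_series (fun k => al (S N + k)%nat)) by (now apply ex_series_incr_n).
    eapply Rle_trans; [apply Series_Rabs|].
    - apply (proj1 (ex_series_incr_n (fun m => Rabs (x m i)) (S N))), ExB.
    - rewrite <- Series_scal_r. apply Series_le; [|now apply ex_series_scal_r].
      intros m. split; [apply Rabs_pos|apply Hx]. }
  assert (E2 : ex_series (fun i => (Series al - sum_n al N) * be i))
    by (now apply ex_series_Rmult_l).
  eapply Rle_trans; [apply Series_Rabs|].
  - exact (ex_series_Rabs_le _ _ B E2).
  - rewrite <- Series_scal_l. apply Series_le; [|exact E2].
    intros i. split; [apply Rabs_pos|apply B].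
Qed.

Definition PS2_comp (phi : nat -> R) (a : nat -> nat -> R) (i j : nat) : R :=
  Series (fun m => phi m * PS2_pow a m i j).

(** The inner series may have a constant term, so infinitely many powers can contribute to one
    coefficient. These sums converge because the (i, j) coefficient of the m-th power is at most M^m
    / (r^j r^i). The value comes from exchanging the sum over [m] first with that over [i], then
    with that over [j]; at half the radius 2^-i and 2^-j serve as majorants. *)
Lemma PS2_comp_val (phi : nat -> R) (a : nat -> nat -> R) (r M : R) :
  0 < r -> (forall n, l1sum r a n <= M) -> ex_series (fun m => Rabs (phi m) * M ^ m) ->
  dominated (PS2_comp phi a) r (Series (fun m => Rabs (phi m) * M ^ m)) /\
  (forall u v, Rabs u <= r / 2 -> Rabs v <= r / 2 ->
     PS2 (PS2_comp phi a) u v = PSeries phi (PS2 a u v)).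
Proof.
  intros Hr Ha Hphi.
  assert (HM : 0 <= M) by (eapply Rle_trans; [apply (l1sum_nonneg r a 0 Hr)|apply Ha]).
  assert (P : forall k, 0 < r ^ k) by (intros; apply pow_lt; lra).
  assert (D : forall m, dominated (PS2_pow a m) r (M ^ m))
    by (intros m; apply l1sum_dominated; trivial; now apply l1sum_pow).
  assert (B : forall i j m, Rabs (phi m * PS2_pow a m i j) * (r ^ j * r ^ i)
                <= Rabs (phi m) * M ^ m).
  { intros i j m. rewrite Rabs_mult, Rmult_assoc.
    apply Rmult_le_compat_l; [apply Rabs_pos|]. rewrite <- Rmult_assoc. apply D. }
  assert (B' : forall i j m, Rabs (phi m * PS2_pow a m i j)
                <= Rabs (phi m) * M ^ m * / (r ^ j * r ^ i)).
  { intros i j m. pose proof (Rmult_lt_0_compat _ _ (P j) (P i)).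
    apply Rmult_le_reg_r with (r ^ j * r ^ i); trivial.
    rewrite (Rmult_assoc _ (/ _)), Rinv_l, Rmult_1_r; [apply B|lra]. }
  split.
  - intros i j. pose proof (Rmult_lt_0_compat _ _ (P j) (P i)).
    rewrite Rmult_assoc. apply Rmult_le_reg_r with (/ (r ^ j * r ^ i));
      [now apply Rinv_0_lt_compat|].
    rewrite Rmult_assoc, Rinv_r, Rmult_1_r by lra.
    unfold PS2_comp. eapply Rle_trans.
    + apply Series_Rabs.
      apply (ex_series_Rabs_le _ (fun m => Rabs (phi m) * M ^ m * / (r ^ j * r ^ i))).
      * intros m.  apply B'.
      * now apply ex_series_scal_r.
    + rewrite <- Series_scal_r. apply Series_le; [|now apply ex_series_scal_r].
      intros m. split; [apply Rabs_pos|apply B'].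
  - intros u v Hu Hv.
    assert (Al : forall m, 0 <= Rabs (phi m) * M ^ m)
      by (intros; apply Rmult_le_pos; [apply Rabs_pos|now apply pow_le]).
    assert (G : ex_series (fun i => (/ 2) ^ i)) by (apply ex_series_geom; rewrite Rabs_pos_eq; lra).
    unfold PSeries at 1.
    rewrite (Series_ext _ (fun m => Series (fun i =>
      PSeries (fun j => phi m * PS2_pow a m i j) v * u ^ i))).
    2:{ intros m. rewrite <- (PS2_pow_val a r M u v m); trivial. unfold PS2, PSeries.
        rewrite <- Series_scal_l. apply Series_ext. intros i.
        rewrite <- Rmult_assoc, <- Series_scal_l. f_equal. apply Series_ext. intros; ring. }
    rewrite (Series_swap _ (fun m => 2 * (Rabs (phi m) * M ^ m)) (fun i => (/ 2) ^ i)).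
    + unfold PS2, PSeries at 1. apply Series_ext. intros i.
      rewrite Series_scal_r. f_equal. unfold PSeries.
      rewrite (Series_swap _ (fun m => Rabs (phi m) * M ^ m * / r ^ i) (fun j => (/ 2) ^ j)).
      * apply Series_ext. intros j. rewrite Series_scal_r. reflexivity.
      * intros m j. rewrite Rabs_mult.
        apply Rle_trans with (Rabs (phi m) * M ^ m * / (r ^ j * r ^ i) * (r ^ j * (/ 2) ^ j)).
        -- apply Rmult_le_compat; try apply Rabs_pos; [apply B'|now apply pow_half].
        -- right. field. pose proof (P i); pose proof (P j). lra.
      * intros m. apply Rmult_le_pos; trivial. left. now apply Rinv_0_lt_compat.
      * intros; apply pow_le; lra.
      * now apply ex_series_scal_r.
      * trivial.
    + intros m i. rewrite Rabs_mult.
      apply Rle_trans with (2 * (Rabs (phi m) * M ^ m) * / r ^ i * (r ^ i * (/ 2) ^ i)).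
      * apply Rmult_le_compat; try apply Rabs_pos; [|now apply pow_half].
        apply Rmult_le_reg_r with (r ^ i); trivial.
        rewrite (Rmult_assoc _ (/ _)), Rinv_l, Rmult_1_r by (pose proof (P i); lra).
        apply (inner_bound (fun i j => phi m * PS2_pow a m i j) r); trivial.
        intros k l. rewrite Rmult_assoc. apply B.
      * right. field. pose proof (P i). lra.
    + intros m. specialize (Al m). lra.
    + intros; apply pow_le; lra.
    + apply (ex_series_Rmult_l 2 _ Hphi).
    + trivial.
Qed.

(** * Germs at the origin of analytic functions of two variables *)

Definition near0 (P : R -> R -> Prop) : Prop :=
  exists d, 0 < d /\ forall u v, Rabs u < d -> Rabs v < d -> P u v.

Lemma near0_and (P Q : R -> R -> Prop) :
  near0 P -> near0 Q -> near0 (fun u v => P u v /\ Q u v).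
Proof.
  intros [d [Hd HP]] [e [He HQ]]. exists (Rmin d e). split.
  - now apply Rmin_glb_lt.
  - intros u v Hu Hv. pose proof (Rmin_l d e). pose proof (Rmin_r d e).
    split; [apply HP|apply HQ]; lra.
Qed.

Lemma near0_impl (P Q : R -> R -> Prop) :
  (forall u v, P u v -> Q u v) -> near0 P -> near0 Q.
Proof. intros H [d [Hd HP]]. exists d. split; auto. Qed.

Lemma near0_at (P : R -> R -> Prop) : near0 P -> P 0 0.
Proof. intros [d [Hd HP]]. apply HP; rewrite Rabs_R0; lra. Qed.

(** A supremum bound on the coefficients replaces the absolute convergence required by [analytic2].
    The two agree up to a smaller radius, and the bound is simpler to carry through the closure
    properties. *)
Definition analytic0 (f : R -> R -> R) : Prop :=
  exists a r M, 0 < r /\ dominated a r M /\ near0 (fun u v => f u v = PS2 a u v).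

Lemma analytic0_ext (f g : R -> R -> R) :
  near0 (fun u v => f u v = g u v) -> analytic0 g -> analytic0 f.
Proof.
  intros H [a [r [M [Hr [Ha E]]]]]. exists a, r, M. repeat split; trivial.
  apply near0_impl with (2 := near0_and _ _ H E). intros u v [-> E']. exact E'.
Qed.

Lemma analytic0_analytic2 (f : R -> R -> R) (s t : R) :
  analytic0 (fun u v => f (s + u) (t + v)) -> analytic2 f s t.
Proof.
  intros [a [r [M [Hr [Ha [d [Hd E]]]]]]].
  (* Half of [r] makes the double geometric series a majorant; [d] is the size of the neighbourhood
     on which the expansion is known. *)
  set (q := Rmin (r / 2) d). exists a, q.
  assert (Hq : 0 < q <= r / 2) by (split; [apply Rmin_glb_lt; lra|apply Rmin_l]).
  assert (Hqd : q <= d) by apply Rmin_r.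
  assert (Hpow : forall k, 0 < q ^ k) by (intros; apply pow_lt; lra).
  assert (Hpow2 : forall k, q ^ k <= r ^ k * (/ 2) ^ k).
  { intros k. rewrite <- Rpow_mult_distr. apply pow_incr. lra. }
  assert (G : ex_series (fun i => (/ 2) ^ i)) by (apply ex_series_geom; rewrite Rabs_pos_eq; lra).
  assert (HM := dominated_nonneg _ _ _ Ha).
  assert (B : forall i j, Rabs (a i j) * q ^ i * q ^ j <= M * (/ 2) ^ i * (/ 2) ^ j).
  { intros i j. apply Rle_trans with (Rabs (a i j) * (r ^ i * (/ 2) ^ i) * (r ^ j * (/ 2) ^ j)).
    - apply Rmult_le_compat; [|apply Rlt_le, Hpow| |apply Hpow2].
      + apply Rmult_le_pos; [apply Rabs_pos|apply Rlt_le, Hpow].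
      + apply Rmult_le_compat_l; [apply Rabs_pos|apply Hpow2].
    - replace (Rabs (a i j) * (r ^ i * (/ 2) ^ i) * (r ^ j * (/ 2) ^ j))
        with (Rabs (a i j) * r ^ j * r ^ i * ((/ 2) ^ i * (/ 2) ^ j)) by ring.
      rewrite (Rmult_assoc M). apply Rmult_le_compat_r; [|apply Ha].
      apply Rmult_le_pos; apply pow_le; lra. }
  assert (Pos : forall i j, 0 <= Rabs (a i j) * q ^ i * q ^ j).
  { intros i j. apply Rmult_le_pos; [|apply Rlt_le, Hpow].
    apply Rmult_le_pos; [apply Rabs_pos|apply Rlt_le, Hpow]. }
  assert (Ex : forall i, ex_series (fun j => Rabs (a i j) * q ^ i * q ^ j)).
  { intros i. apply ex_series_Rabs, (ex_series_Rabs_le _ (fun j => M * (/ 2) ^ i * (/ 2) ^ j)).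
    - intros j. rewrite Rabs_pos_eq; auto.
    - now apply ex_series_Rmult_l. }
  split; [lra|]. split; [exact Ex|]. split.
  - assert (Sb : forall i, 0 <= Series (fun j => Rabs (a i j) * q ^ i * q ^ j) <= 2 * M * (/ 2) ^ i).
    { intros i. split.
      (* Zero is written as a series of zero terms, so that termwise comparison gives
         nonnegativity. *)
      - rewrite <- (Rmult_0_l (Series (fun _ => 1))), <- Series_scal_l.
        apply Series_le; [|apply Ex]. intros j. split; [lra|]. rewrite Rmult_0_l. apply Pos.
      - apply Rle_trans with (Series (fun j => M * (/ 2) ^ i * (/ 2) ^ j)).
        + apply Series_le; [|now apply ex_series_Rmult_l]. intros j; split; auto.
        + rewrite Series_scal_l, Series_geom by (rewrite Rabs_pos_eq; lra).
          right. field. }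
    apply ex_series_Rabs, (ex_series_Rabs_le _ (fun i => 2 * M * (/ 2) ^ i)).
    + intros i. rewrite Rabs_pos_eq; apply Sb.
    + now apply ex_series_Rmult_l.
  - intros u v Hu Hv. rewrite E by lra. unfold PS2, PSeries at 1.
    apply Series_ext. intros i. unfold PSeries. rewrite <- Series_scal_r.
    apply Series_ext. intros j. ring.
Qed.

Lemma analytic0_fst (a : nat -> R) :
  Rbar_lt 0 (CV_radius a) -> analytic0 (fun u _ => PSeries a u).
Proof.
  intros H. destruct (CV_radius_bound a H) as [r [M [Hr Ha]]].
  exists (fun i j => match j with O => a i | _ => 0 end), r, M. split; [exact Hr|split].
  - intros i [|j]; simpl.
    + rewrite Rmult_1_r. apply Ha.
    + rewrite Rabs_R0. apply Rle_trans with (Rabs (a 0%nat) * r ^ 0); [|apply Ha].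
      simpl. pose proof (Rabs_pos (a 0%nat)). lra.
  - exists 1. split; [lra|]. intros. symmetry. apply PS2_col.
Qed.

Lemma analytic0_snd (a : nat -> R) :
  Rbar_lt 0 (CV_radius a) -> analytic0 (fun _ v => PSeries a v).
Proof.
  intros H. destruct (CV_radius_bound a H) as [r [M [Hr Ha]]].
  exists (fun i j => match i with O => a j | _ => 0 end), r, M. split; [exact Hr|split].
  - intros [|i] j; simpl.
    + rewrite Rmult_1_r. apply Ha.
    + rewrite Rabs_R0. apply Rle_trans with (Rabs (a 0%nat) * r ^ 0); [|apply Ha].
      simpl. pose proof (Rabs_pos (a 0%nat)). lra.
  - exists 1. split; [lra|]. intros. symmetry. apply PS2_row.
Qed.

Lemma analytic0_const (c : R) : analytic0 (fun _ _ => c).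
Proof.
  exists (fun i j => match i, j with O, O => c | _, _ => 0 end), 1, (Rabs c).
  split; [lra|split].
  - intros [|i] [|j]; rewrite ?pow1, ?Rabs_R0; pose proof (Rabs_pos c); simpl; lra.
  - exists 1. split; [lra|]. intros u v _ _.
    unfold PS2. rewrite PSeries_ext_finite0.
    + now rewrite PSeries_ext_finite0.
    + intros k. apply PSeries_const_0.
Qed.

Lemma near0_half (r : R) : 0 < r -> near0 (fun u v => Rabs u <= r / 2 /\ Rabs v <= r / 2).
Proof. intros Hr. exists (r / 2). split; [lra|]. intros; lra. Qed.

Lemma analytic0_common (f g : R -> R -> R) :
  analytic0 f -> analytic0 g -> exists a b r M, 0 < r /\
    (forall n, l1sum r a n <= M) /\ (forall n, l1sum r b n <= M) /\
    near0 (fun u v => f u v = PS2 a u v) /\ near0 (fun u v => g u v = PS2 b u v).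
Proof.
  intros [a [r [M [Hr [Ha E]]]]] [b [p [N [Hp [Hb F]]]]].
  exists a, b, (Rmin r p / 2), (Rmax (4 * M) (4 * N)).
  assert (0 < Rmin r p) by (now apply Rmin_glb_lt).
  pose proof (Rmin_l r p). pose proof (Rmin_r r p).
  split; [lra|]. repeat split; trivial; intros n.
  - eapply Rle_trans; [|apply Rmax_l]. apply dominated_l1sum; trivial.
    apply dominated_le with r; trivial; lra.
  - eapply Rle_trans; [|apply Rmax_r]. apply dominated_l1sum; trivial.
    apply dominated_le with p; trivial; lra.
Qed.

Lemma analytic0_plus (f g : R -> R -> R) :
  analytic0 f -> analytic0 g -> analytic0 (fun u v => f u v + g u v).
Proof.
  intros Hf Hg. destruct (analytic0_common f g Hf Hg) as [a [b [r [M [Hr [Ha [Hb [E F]]]]]]]].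
  pose proof (l1sum_dominated r M a Hr Ha) as Da.
  pose proof (l1sum_dominated r M b Hr Hb) as Db.
  exists (fun i j => a i j + b i j), r, (M + M). split; [exact Hr|split].
  - intros i j. specialize (Da i j). specialize (Db i j).
    apply Rle_trans with ((Rabs (a i j) + Rabs (b i j)) * r ^ j * r ^ i); [|lra].
    repeat apply Rmult_le_compat_r; try (apply pow_le; lra). apply Rabs_triang.
  - apply near0_impl with (2 := near0_and _ _ (near0_half r Hr) (near0_and _ _ E F)).
    intros u v [[Hu Hv] [-> ->]]. symmetry. now apply (PS2_plus a b r M M).
Qed.

Lemma analytic0_mult (f g : R -> R -> R) :
  analytic0 f -> analytic0 g -> analytic0 (fun u v => f u v * g u v).
Proof.
  intros Hf Hg. destruct (analytic0_common f g Hf Hg) as [a [b [r [M [Hr [Ha [Hb [E F]]]]]]]].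
  pose proof (l1sum_dominated r M a Hr Ha) as Da.
  pose proof (l1sum_dominated r M b Hr Hb) as Db.
  exists (PS2_mult a b), r, (M * M). split; [exact Hr|split].
  - apply l1sum_dominated; trivial. intros n.
    eapply Rle_trans; [now apply l1sum_mult|].
    apply Rmult_le_compat; auto using l1sum_nonneg.
  - apply near0_impl with (2 := near0_and _ _ (near0_half r Hr) (near0_and _ _ E F)).
    intros u v [[Hu Hv] [-> ->]]. symmetry. now apply (PS2_mult_val a b r M M).
Qed.

Lemma analytic0_opp (f : R -> R -> R) : analytic0 f -> analytic0 (fun u v => - f u v).
Proof.
  intros Hf. apply analytic0_ext with (fun u v => -1 * f u v).
  - exists 1. split; [lra|]. intros; ring.
  - apply analytic0_mult; [apply analytic0_const|exact Hf].
Qed.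

Lemma analytic0_minus (f g : R -> R -> R) :
  analytic0 f -> analytic0 g -> analytic0 (fun u v => f u v - g u v).
Proof. intros Hf Hg. apply analytic0_plus; [|apply analytic0_opp]; trivial. Qed.

Lemma analytic0_comp_entire (phi : nat -> R) (f : R -> R -> R) :
  CV_radius phi = p_infty -> analytic0 f -> analytic0 (fun u v => PSeries phi (f u v)).
Proof.
  intros Hphi Hf. destruct (analytic0_common f f Hf Hf) as [a [_ [r [M [Hr [Ha [_ [E _]]]]]]]].
  assert (HM : 0 <= M) by (eapply Rle_trans; [apply (l1sum_nonneg r a 0 Hr)|apply Ha]).
  assert (S : ex_series (fun m => Rabs (phi m) * M ^ m)).
  { apply ex_series_ext with (fun m => Rabs (phi m * M ^ m)).
    - intros m. rewrite Rabs_mult, (Rabs_pos_eq (M ^ m)); trivial. now apply pow_le.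
    - apply CV_disk_inside. now rewrite Hphi. }
  destruct (PS2_comp_val phi a r M Hr Ha S) as [D V].
  exists (PS2_comp phi a), r, (Series (fun m => Rabs (phi m) * M ^ m)).
  split; [exact Hr|split; [exact D|]].
  apply near0_impl with (2 := near0_and _ _ (near0_half r Hr) E).
  intros u v [[Hu Hv] ->]. symmetry. now apply V.
Qed.

(** Shrinking the radius by [th] multiplies the (i, j) term by th^(i+j), which is at most [th]
    except for the constant term, and that one is zero. *)
Lemma dominated_shrink (a : nat -> nat -> R) (r M th : R) :
  0 < r -> 0 < th <= 1 -> a 0%nat 0%nat = 0 -> dominated a r M ->
  dominated a (th * r) (th * M).
Proof.
  intros Hr Hth H0 Ha i j. pose proof (dominated_nonneg _ _ _ Ha) as HM.
  destruct (Nat.eq_dec (i + j) 0) as [Hz|Hz].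
  - assert (i = 0%nat) by lia. assert (j = 0%nat) by lia. subst i j.
    rewrite H0, Rabs_R0, !Rmult_0_l. apply Rmult_le_pos; lra.
  - rewrite !Rpow_mult_distr.
    replace (Rabs (a i j) * (th ^ j * r ^ j) * (th ^ i * r ^ i))
      with (th ^ (i + j) * (Rabs (a i j) * r ^ j * r ^ i)) by (rewrite pow_add; ring).
    apply Rmult_le_compat.
    + apply pow_le; lra.
    + repeat apply Rmult_le_pos; try apply Rabs_pos; apply pow_le; lra.
    + destruct (i + j)%nat as [|k]; [lia|]. simpl.
      assert (th ^ k <= 1) by (rewrite <- (pow1 k); apply pow_incr; lra).
      apply Rle_trans with (th * 1); [|lra]. apply Rmult_le_compat_l; lra.
    + apply Ha.
Qed.

(** A germ vanishing at the origin has an l1 norm as small as desired on a small enough polydisk.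
    This is what allows substitution into a power series of finite radius. *)
Lemma analytic0_small (f : R -> R -> R) (eps : R) :
  analytic0 f -> f 0 0 = 0 -> 0 < eps ->
  exists a r, 0 < r /\ (forall n, l1sum r a n <= eps) /\ dominated a r eps /\
    near0 (fun u v => f u v = PS2 a u v) /\ near0 (fun u v => Rabs (f u v) < eps).
Proof.
  intros [a [r [M [Hr [Ha E]]]]] H0 He.
  assert (H00 : a 0%nat 0%nat = 0).
  { rewrite <- PS2_00, <- (near0_at _ E : f 0 0 = _). exact H0. }
  pose proof (dominated_nonneg _ _ _ Ha) as HM.
  (* With the 8, [th * M] is at most [eps / 8], so the factor 4 lost in [dominated_l1sum] and
     [PS2_bound] still leaves [eps / 2]. The [M + 1] covers the case [M = 0]. *)
  set (th := Rmin 1 (eps / (8 * (M + 1)))).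
  assert (Hq : 0 < eps / (8 * (M + 1))) by (apply Rdiv_lt_0_compat; lra).
  assert (Hth : 0 < th <= 1) by (split; [apply Rmin_glb_lt; lra|apply Rmin_l]).
  assert (Hle : th * M <= eps / 8).
  { apply Rle_trans with (eps / (8 * (M + 1)) * (M + 1)).
    - apply Rmult_le_compat; try lra. apply Rmin_r.
    - right. field. lra. }
  assert (D := dominated_shrink a r M th Hr Hth H00 Ha).
  assert (Hr' : 0 < th * r) by (apply Rmult_lt_0_compat; lra).
  exists a, (th * r / 2). split; [lra|]. split; [|split; [|split]].
  - intros n. eapply Rle_trans; [apply dominated_l1sum; [exact Hr'|exact D]|]. lra.
  - apply (dominated_le a (th * r)); [lra|]. intros i j. specialize (D i j). lra.
  - exact E.
  - apply near0_impl with (2 := near0_and _ _ (near0_half _ Hr') E).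
    intros u v [[Hu Hv] ->]. eapply Rle_lt_trans; [apply (PS2_bound a (th * r) (th * M)); trivial|].
    lra.
Qed.

Lemma analytic0_comp (phi : nat -> R) (g : R -> R) (f : R -> R -> R) (eta : R) :
  0 < eta -> (forall z, Rabs z < eta -> g z = PSeries phi z) ->
  Rbar_lt 0 (CV_radius phi) -> analytic0 f -> f 0 0 = 0 -> analytic0 (fun u v => g (f u v)).
Proof.
  intros He Hg Hphi Hf H0.
  destruct (CV_radius_bound phi Hphi) as [p [K [Hp HK]]].
  (* Below [eta] the function [g] is given by its series; below [p / 2] that series converges
     absolutely. *)
  set (eps := Rmin eta (p / 2)).
  assert (Heps : 0 < eps) by (apply Rmin_glb_lt; lra).
  assert (eps <= eta) by apply Rmin_l. assert (eps <= p / 2) by apply Rmin_r.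
  destruct (analytic0_small f eps Hf H0 Heps) as [a [r [Hr [Ha [_ [E L]]]]]].
  assert (S : ex_series (fun m => Rabs (phi m) * eps ^ m)).
  { apply ex_series_ext with (fun m => Rabs (phi m * eps ^ m)).
    - intros m. rewrite Rabs_mult, (Rabs_pos_eq (eps ^ m)); trivial. apply pow_le; lra.
    - apply CV_disk_inside. apply (CV_radius_lower phi p K); trivial. rewrite Rabs_pos_eq; lra. }
  destruct (PS2_comp_val phi a r eps Hr Ha S) as [D V].
  exists (PS2_comp phi a), r, (Series (fun m => Rabs (phi m) * eps ^ m)).
  split; [exact Hr|split; [exact D|]].
  apply near0_impl with (2 := near0_and _ _ (near0_half r Hr) (near0_and _ _ E L)).
  intros u v [[Hu Hv] [E1 L1]]. rewrite Hg by lra. rewrite E1. symmetry. now apply V.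
Qed.

Lemma analytic0_near_neq0 (f : R -> R -> R) : analytic0 f -> f 0 0 <> 0 ->
  near0 (fun u v => 0 < f u v / f 0 0).
Proof.
  intros Hf H0.
  assert (Hw : analytic0 (fun u v => f u v * / f 0 0 - 1)).
  { apply analytic0_minus; [apply analytic0_mult; [exact Hf|]|]; apply analytic0_const. }
  destruct (analytic0_small _ (/ 2) Hw) as [_ [_ [_ [_ [_ [_ L]]]]]]; [field; exact H0|lra|].
  apply near0_impl with (2 := L). intros u v H. apply Rabs_def2 in H. unfold Rdiv. lra.
Qed.

(** Made for homogeneous [g], such as the inverse and the inverse square root: the value at the
    origin is factored out, and f / f(0,0) - 1 vanishes there, so that a single expansion around 1
    suffices. *)
Lemma analytic0_comp_scaled (phi : nat -> R) (g : R -> R) (f : R -> R -> R) :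
  Rbar_lt 0 (CV_radius phi) ->
  (forall z, Rabs z < 1 -> g (f 0 0 * (1 + z)) = g (f 0 0) * PSeries phi z) ->
  f 0 0 <> 0 -> analytic0 f -> analytic0 (fun u v => g (f u v)).
Proof.
  intros Hphi Hg H0 Hf.
  apply analytic0_ext with (fun u v => g (f 0 0 * (1 + (f u v * / f 0 0 - 1)))).
  { exists 1. split; [lra|]. intros u v _ _. f_equal. field. exact H0. }
  apply analytic0_ext with (fun u v => g (f 0 0) * PSeries phi (f u v * / f 0 0 - 1)).
  { assert (Hw : analytic0 (fun u v => f u v * / f 0 0 - 1)).
    { apply analytic0_minus; [apply analytic0_mult; [exact Hf|]|]; apply analytic0_const. }
    destruct (analytic0_small _ 1 Hw) as [_ [_ [_ [_ [_ [_ L]]]]]]; [field; exact H0|lra|].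
    apply near0_impl with (2 := L). intros u v H. now apply Hg. }
  apply analytic0_mult; [apply analytic0_const|].
  apply (analytic0_comp phi _ _ 1); trivial; [lra| |field; exact H0].
  apply analytic0_minus; [apply analytic0_mult; [exact Hf|]|]; apply analytic0_const.
Qed.

Lemma analytic0_inv (f : R -> R -> R) : analytic0 f -> f 0 0 <> 0 -> analytic0 (fun u v => / f u v).
Proof.
  intros Hf H0. apply (analytic0_comp_scaled (fun m => (-1) ^ m)); trivial.
  - apply Rbar_lt_le_trans with 1; [simpl; lra|].
    apply (proj1 (CV_radius_bounded _)). exists 1. intros k.
    rewrite pow1, Rmult_1_r, pow_1_abs. lra.
  - intros z Hz. unfold PSeries.
    rewrite (Series_ext _ (fun m => (- z) ^ m)).
    + rewrite Series_geom by (now rewrite Rabs_Ropp). apply Rabs_def2 in Hz. field. lra.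
    + intros m. rewrite <- Rpow_mult_distr. f_equal. ring.
Qed.

(** The binomial coefficients with exponent -1/2. *)
Fixpoint inv_sqrt_coef (m : nat) : R :=
  match m with
  | O => 1
  | S m => - (INR m + / 2) / (INR m + 1) * inv_sqrt_coef m
  end.

Lemma inv_sqrt_coef_bound (m : nat) : Rabs (inv_sqrt_coef m) <= 1.
Proof.
  induction m as [|m IH]; simpl; [rewrite Rabs_R1; lra|].
  pose proof (pos_INR m). rewrite Rabs_mult.
  assert (Rabs (- (INR m + / 2) / (INR m + 1)) <= 1).
  { unfold Rdiv. rewrite Rabs_mult, Rabs_Ropp, Rabs_inv, !Rabs_pos_eq by lra.
    apply Rmult_le_reg_r with (INR m + 1); [lra|].
    rewrite Rmult_assoc, Rinv_l by lra. lra. }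
  pose proof (Rabs_pos (inv_sqrt_coef m)).
  apply Rle_trans with (1 * 1); [|lra].
  apply Rmult_le_compat; trivial; apply Rabs_pos.
Qed.

Lemma inv_sqrt_coef_CV (z : R) : Rabs z < 1 -> Rbar_lt (Rabs z) (CV_radius inv_sqrt_coef).
Proof.
  intros Hz. apply (CV_radius_lower _ 1 1); trivial; [lra|].
  intros k. rewrite pow1, Rmult_1_r. apply inv_sqrt_coef_bound.
Qed.

(* The series [w] solves [2 (1 + z) w' = - w], so [(1 + z) w^2] is constant. *)
Lemma inv_sqrt_PSeries (z : R) : Rabs z < 1 -> / sqrt (1 + z) = PSeries inv_sqrt_coef z.
Proof.
  set (w := PSeries inv_sqrt_coef). set (dw := PSeries (PS_derive inv_sqrt_coef)).
  assert (D : forall x, Rabs x < 1 -> is_derive w x (dw x))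
    by (intros; now apply is_derive_PSeries, inv_sqrt_coef_CV).
  assert (CVd : forall x, Rabs x < 1 -> ex_pseries (PS_derive inv_sqrt_coef) x).
  { intros. apply CV_radius_inside. rewrite CV_radius_derive. now apply inv_sqrt_coef_CV. }
  assert (O : forall x, Rabs x < 1 -> 2 * ((1 + x) * dw x) = - w x).
  { intros x Hx. unfold dw, w.
    assert (Exd := CVd x Hx).
    assert (E2 : x * PSeries (PS_derive inv_sqrt_coef) x
                 = PSeries (PS_incr_1 (PS_derive inv_sqrt_coef)) x)
      by (symmetry; apply PSeries_incr_1).
    rewrite Rmult_plus_distr_r, Rmult_1_l, E2, <- PSeries_plus; trivial.
    - replace (- PSeries inv_sqrt_coef x) with (2 * (- / 2 * PSeries inv_sqrt_coef x)) by field.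
      f_equal. rewrite <- PSeries_scal. apply PSeries_ext. intros [|n].
      + unfold PS_plus, PS_incr_1, PS_derive, PS_scal. simpl.
        unfold plus, zero, scal; simpl; unfold mult; simpl. field.
      + unfold PS_plus, PS_incr_1, PS_derive, PS_scal.
        unfold plus, zero, scal; simpl; unfold mult; simpl.
        change (inv_sqrt_coef (S (S n))) with
          (- (INR (S n) + / 2) / (INR (S n) + 1) * inv_sqrt_coef (S n)).
        change (- (INR n + / 2) / (INR n + 1) * inv_sqrt_coef n) with (inv_sqrt_coef (S n)).
        change (match n with O => 1 | S _ => INR n + 1 end) with (INR (S n)).
        rewrite S_INR. pose proof (pos_INR n). field. lra.
    - apply ex_pseries_incr_1. exact Exd. }
  assert (K : forall x, Rabs x < 1 -> (1 + x) * w x ^ 2 = 1).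
  { intros x Hx.
    assert (DK : forall y, Rabs y < 1 -> is_derive (fun y => (1 + y) * w y ^ 2) y 0).
    { intros y Hy. auto_derive.
      - exists (dw y). now apply D.
      - replace (Derive (fun x : R => w x) y) with (dw y)
          by (symmetry; apply is_derive_unique, D, Hy).
        specialize (O y Hy).
        replace (1 * (w y * (w y * 1)) + (1 + y) * (1 * dw y * ((1 + 1) * (w y * 1))))
          with (w y * (w y + 2 * ((1 + y) * dw y))) by ring.
        rewrite O. ring. }
    assert (w0 : w 0 = 1) by (unfold w; rewrite PSeries_0; reflexivity).
    replace 1 with ((1 + 0) * w 0 ^ 2) at 2 by (rewrite w0; ring).
    destruct (MVT_gen (fun y => (1 + y) * w y ^ 2) 0 x (fun _ => 0)) as [c [_ Hc]].
    - intros y Hy. apply DK. apply Rabs_def1; apply Rabs_def2 in Hx;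
      revert Hy; unfold Rmin, Rmax; destruct (Rle_dec 0 x); lra.
    - intros y Hy. apply derivable_continuous_pt. exists 0.
      apply is_derive_Reals, DK. apply Rabs_def1; apply Rabs_def2 in Hx;
      revert Hy; unfold Rmin, Rmax; destruct (Rle_dec 0 x); lra.
    - simpl in Hc |- *. lra. }
  assert (Wc : forall x, Rabs x < 1 -> continuity_pt w x).
  { intros x Hx. apply derivable_continuous_pt. exists (dw x). now apply is_derive_Reals, D. }
  (* [K] determines [w] only up to sign. It also excludes zeros, so by the intermediate value
     theorem [w] keeps the sign of [w 0 = 1]. *)
  assert (Wpos : forall x, Rabs x < 1 -> 0 < w x).
  { intros x Hx. destruct (Rlt_or_le 0 (w x)) as [|Hn]; [trivial|exfalso].
    assert (w0 : w 0 = 1) by (unfold w; rewrite PSeries_0; reflexivity).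
    assert (Wnz : forall y, Rabs y < 1 -> w y <> 0).
    { intros y Hy E. specialize (K y Hy). rewrite E in K. simpl in K. lra. }
    pose proof (Wnz x Hx) as Hnz.
    destruct (Rtotal_order x 0) as [Hlt|[->|Hgt]]; [| lra |].
    - destruct (Ranalysis5.IVT_interv w x 0) as [c [Hc1 Hc2]]; try lra.
      + intros y Hy. apply Wc. apply Rabs_def1; apply Rabs_def2 in Hx; lra.
      + apply (Wnz c); trivial. apply Rabs_def1; apply Rabs_def2 in Hx; lra.
    - destruct (Ranalysis5.IVT_interv (- w)%F 0 x) as [c [Hc1 Hc2]]; unfold opp_fct in *; try lra.
      + intros y Hy. apply continuity_pt_opp, Wc. apply Rabs_def1; apply Rabs_def2 in Hx; lra.
      + apply (Wnz c); [|lra]. apply Rabs_def1; apply Rabs_def2 in Hx; lra. }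
  intros Hz. specialize (K z Hz). specialize (Wpos z Hz). fold w.
  apply Rabs_def2 in Hz.
  replace (1 + z) with (/ w z * / w z).
  - rewrite sqrt_square, Rinv_inv; [trivial|]. left. now apply Rinv_0_lt_compat.
  - apply Rmult_eq_reg_r with (w z ^ 2); [|apply pow_nonzero; lra].
    rewrite K. field. lra.
Qed.

Lemma analytic0_inv_sqrt (f : R -> R -> R) :
  analytic0 f -> 0 < f 0 0 -> analytic0 (fun u v => / sqrt (f u v)).
Proof.
  intros Hf H0. apply (analytic0_comp_scaled inv_sqrt_coef (fun x => / sqrt x)); trivial.
  - rewrite <- Rabs_R0. apply inv_sqrt_coef_CV. rewrite Rabs_R0; lra.
  - intros z Hz. rewrite <- inv_sqrt_PSeries; trivial. apply Rabs_def2 in Hz.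
    rewrite sqrt_mult by lra. apply Rinv_mult.
  - lra.
Qed.

(** Since u^(k+1) - v^(k+1) is (u - v) times the sum of u^i v^j over i + j = k, the quotient has the
    coefficients a_(i+j+1). It is analytic across u = v, where a pointwise quotient would not be
    defined. *)
Lemma analytic0_diff_quotient (a : nat -> R) :
  Rbar_lt 0 (CV_radius a) ->
  exists D, analytic0 D /\ D 0 0 = a 1%nat /\
    near0 (fun u v => (u - v) * D u v = PSeries a u - PSeries a v).
Proof.
  intros H. destruct (CV_radius_bound a H) as [r [M [Hr Ha]]].
  set (d := fun i j => a (S (i + j))).
  assert (Dd : dominated d r (M / r)).
  { intros i j. apply Rmult_le_reg_r with r; trivial.
    replace (M / r * r) with M by (field; lra).
    replace (Rabs (d i j) * r ^ j * r ^ i * r) with (Rabs (a (S (i + j))) * r ^ S (i + j)).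
    - apply Ha.
    - unfold d. simpl. rewrite pow_add. ring. }
  exists (PS2 d). split; [|split].
  - exists d, r, (M / r). split; [trivial|split; [trivial|]]. exists 1. split; [lra|]. trivial.
  - apply PS2_00.
  - apply near0_impl with (2 := near0_half r Hr). intros u v [Hu Hv].
    assert (Ia : forall x, Rabs x <= r / 2 -> ex_pseries a x).
    { intros x Hx. apply CV_radius_inside, (CV_radius_lower a r M); trivial; lra. }
    set (A := fun i => PSeries (d i) v).
    (* Multiplication by [v] shifts the row index up to a coefficient of [a]. Summed against the
       powers of [u], this makes (u - v) times the double series telescope. *)
    assert (Rec : forall i, v * A (S i) = A i - a (S i)).
    { intros i. unfold A. rewrite (PSeries_decr_1 (d i)).
      - unfold d at 2. rewrite Nat.add_0_r.
        rewrite (PSeries_ext (PS_decr_1 (d i)) (d (S i))); [ring|].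
        intros k. unfold PS_decr_1, d. f_equal. lia.
      - apply CV_radius_inside, (inner_CV d r (M / r)); trivial; lra. }
    assert (ExA : ex_pseries A u) by (apply CV_radius_inside, (outer_CV d r (M / r)); trivial; lra).
    change (PS2 d u v) with (PSeries A u).
    assert (E0 : v * A 0%nat = PSeries a v - a 0%nat).
    { rewrite (PSeries_decr_1 a) by auto. unfold A. rewrite (PSeries_ext (d 0%nat) (PS_decr_1 a)).
      - ring.
      - reflexivity. }
    assert (E1 : PSeries A u = A 0%nat + u * PSeries (PS_decr_1 A) u) by (now apply PSeries_decr_1).
    assert (ExD : ex_pseries (PS_decr_1 A) u).
    { apply CV_radius_inside. rewrite CV_radius_decr_1. apply (outer_CV d r (M / r)); trivial; lra. }
    assert (E2 : v * PSeries (PS_decr_1 A) u = PSeries A u - PSeries (PS_decr_1 a) u).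
    { rewrite <- PSeries_scal, <- PSeries_minus; trivial.
      - apply PSeries_ext. intros k. unfold PS_scal, PS_minus, PS_plus, PS_opp, PS_decr_1.
        unfold scal, plus, opp; simpl; unfold mult; simpl. rewrite Rec. ring.
      - apply CV_radius_inside. rewrite CV_radius_decr_1.
        apply (CV_radius_lower a r M); trivial; lra. }
    assert (E3 : PSeries a u = a 0%nat + u * PSeries (PS_decr_1 a) u)
      by (apply PSeries_decr_1; auto).
    rewrite Rmult_minus_distr_r.
    assert (E4 : v * PSeries A u = v * A 0%nat + u * (v * PSeries (PS_decr_1 A) u))
      by (rewrite E1 at 1; ring).
    rewrite E4, E2, E0, E3. ring.
Qed.

(** * Entire power series *)

(** Bounds at every radius are used instead of an infinite [CV_radius] because they pass directly to
    differences, multiples and dilations; for derivatives and shifts the equivalence with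
    [CV_radius] is used. *)
Definition entire (a : nat -> R) : Prop :=
  forall r, 0 < r -> exists M, forall k, Rabs (a k) * r ^ k <= M.

Lemma entire_CV (a : nat -> R) : entire a -> CV_radius a = p_infty.
Proof.
  intros H.
  assert (L : forall r : R, 0 < r -> Rbar_lt r (CV_radius a)).
  { intros r Hr. destruct (H (r + 1)) as [M HM]; [lra|].
    rewrite <- (Rabs_pos_eq r) by lra. apply (CV_radius_lower a (r + 1) M); trivial; [lra|].
    rewrite Rabs_pos_eq; lra. }
  destruct (CV_radius a) as [c| |]; trivial.
  - specialize (L (Rabs c + 1)). pose proof (Rle_abs c). pose proof (Rabs_pos c). simpl in L. lra.
  - specialize (L 1). simpl in L. lra.
Qed.

Lemma CV_entire (a : nat -> R) : CV_radius a = p_infty -> entire a.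
Proof.
  intros H r Hr.
  assert (E : ex_series (fun n => Rabs (a n * r ^ n))) by (apply CV_disk_inside; now rewrite H).
  destruct (filterlim_bounded (fun n => Rabs (a n * r ^ n))) as [M HM].
  { exists 0. exact (ex_series_lim_0 _ E). }
  exists M. intros k. specialize (HM k).
  unfold norm in HM; simpl in HM; unfold abs in HM; simpl in HM.
  rewrite Rabs_Rabsolu, Rabs_mult, (Rabs_pos_eq (r ^ k)) in HM; [exact HM|].
  apply pow_le; lra.
Qed.

Lemma entire_derive (a : nat -> R) : entire a -> entire (PS_derive a).
Proof. intros H. apply CV_entire. rewrite CV_radius_derive. now apply entire_CV. Qed.

Lemma entire_decr_1 (a : nat -> R) : entire a -> entire (PS_decr_1 a).
Proof. intros H. apply CV_entire. rewrite CV_radius_decr_1. now apply entire_CV. Qed.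

Lemma entire_minus (a b : nat -> R) : entire a -> entire b -> entire (fun k => a k - b k).
Proof.
  intros Ha Hb r Hr. destruct (Ha r Hr) as [M HM]. destruct (Hb r Hr) as [N HN].
  exists (M + N). intros k. specialize (HM k). specialize (HN k).
  apply Rle_trans with ((Rabs (a k) + Rabs (b k)) * r ^ k); [|lra].
  apply Rmult_le_compat_r; [apply pow_le; lra|].
  unfold Rminus. rewrite <- (Rabs_Ropp (b k)). apply Rabs_triang.
Qed.

Lemma entire_scal (c : R) (a : nat -> R) : entire a -> entire (fun k => c * a k).
Proof.
  intros Ha r Hr. destruct (Ha r Hr) as [M HM]. exists (Rabs c * M). intros k.
  rewrite Rabs_mult, Rmult_assoc. apply Rmult_le_compat_l; [apply Rabs_pos|auto].
Qed.

Lemma entire_dilate (c : R) (a : nat -> R) : 0 < c -> entire a -> entire (fun k => a k * c ^ k).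
Proof.
  intros Hc Ha r Hr. destruct (Ha (c * r)) as [M HM]; [now apply Rmult_lt_0_compat|].
  exists M. intros k. rewrite Rabs_mult, (Rabs_pos_eq (c ^ k)), Rmult_assoc, <- Rpow_mult_distr; auto.
  apply pow_le; lra.
Qed.

Lemma entire_fact (a : nat -> R) : (forall k, Rabs (a k) <= / INR (fact k)) -> entire a.
Proof.
  intros H r Hr.
  assert (L : is_lim_seq (fun k => r ^ k / INR (fact k)) 0)
    by (apply is_lim_seq_Reals, cv_speed_pow_fact).
  destruct (filterlim_bounded (fun k => r ^ k / INR (fact k))) as [M HM].
  { exists 0. exact L. }
  exists M. intros k. specialize (HM k).
  unfold norm in HM; simpl in HM; unfold abs in HM; simpl in HM.
  eapply Rle_trans; [|exact HM]. eapply Rle_trans; [|apply Rle_abs].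
  unfold Rdiv. rewrite Rmult_comm. apply Rmult_le_compat_l; [apply pow_le; lra|apply H].
Qed.

Lemma PSeries_entire_bounded (a : nat -> R) :
  entire a -> exists M, forall x, Rabs x <= 1 -> Rabs (PSeries a x) <= M.
Proof.
  intros H. destruct (H 2) as [M HM]; [lra|]. exists (2 * M). intros x Hx.
  apply abs_series_bound. intros n. apply half_radius_sum with 2; trivial; lra.
Qed.

Lemma is_derive_entire (a : nat -> R) (x : R) :
  entire a -> is_derive (PSeries a) x (PSeries (PS_derive a) x).
Proof. intros H. apply is_derive_PSeries. now rewrite entire_CV. Qed.

Lemma PSeries_entire_decr_1 (a : nat -> R) (x : R) :
  entire a -> PSeries a x = a 0%nat + x * PSeries (PS_decr_1 a) x.
Proof. intros H. apply PSeries_decr_1, CV_radius_inside. now rewrite entire_CV. Qed.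

(** * The Hankel function as a function of the squared distance *)

Definition bessel_coef (m : nat) : R := (-1) ^ m / INR (fact m) ^ 2.
Definition bessel_Y_coef (m : nat) : R := (-1) ^ m * harmonic m / INR (fact m) ^ 2.

Lemma harmonic_bound (m : nat) : 0 <= harmonic m <= INR m.
Proof.
  unfold harmonic. induction m as [|m IH].
  - rewrite sum_n_m_zero by lia. unfold zero; simpl. lra.
  - rewrite sum_n_Sm by lia. unfold plus; simpl plus. rewrite S_INR.
    pose proof (pos_INR m).
    assert (0 < / (INR m + 1) <= 1).
    { split; [apply Rinv_0_lt_compat; lra|]. rewrite <- Rinv_1. apply Rinv_le_contravar; lra. }
    simpl. destruct m; simpl in *; lra.
Qed.

Lemma bessel_coef_entire : entire bessel_coef.
Proof.
  apply entire_fact. intros k. unfold bessel_coef. pose proof (INR_fact_lt_0 k) as F.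
  assert (1 <= INR (fact k)) by (apply (le_INR 1), lt_O_fact).
  unfold Rdiv. rewrite Rabs_mult, pow_1_abs, Rabs_pos_eq, Rmult_1_l.
  - apply Rinv_le_contravar; trivial. simpl. rewrite Rmult_1_r.
    rewrite <- (Rmult_1_l (INR (fact k))) at 1. apply Rmult_le_compat_r; lra.
  - left. apply Rinv_0_lt_compat, pow_lt, F.
Qed.

(** One of the two factorials absorbs the harmonic number, as h_k <= k <= k!; the other gives the
    entire bound. *)
Lemma bessel_Y_coef_entire : entire bessel_Y_coef.
Proof.
  apply entire_fact. intros k. unfold bessel_Y_coef. pose proof (INR_fact_lt_0 k) as F.
  destruct (harmonic_bound k) as [H1 H2].
  assert (INR k <= INR (fact k)).
  { apply le_INR. destruct k; [simpl; lia|]. simpl. pose proof (lt_O_fact k). nia. }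
  unfold Rdiv. rewrite !Rabs_mult, pow_1_abs, Rmult_1_l, (Rabs_pos_eq (harmonic k)), Rabs_pos_eq.
  - apply Rle_trans with (INR (fact k) * / INR (fact k) ^ 2).
    + apply Rmult_le_compat_r; [left; apply Rinv_0_lt_compat, pow_lt, F|lra].
    + right. field. lra.
  - left. apply Rinv_0_lt_compat, pow_lt, F.
  - trivial.
Qed.

(** Coefficients in the variable r^2: [jc k] gives J_0(k r), and (pi/2) Y_0(k r) is ln(r) J_0(k r)
    plus the series of [ec k]. The logarithm in [ec] comes from ln(k r / 2) = ln r + ln(k / 2). *)
Definition jc (k : R) (m : nat) : R := bessel_coef m * (k ^ 2 / 4) ^ m.
Definition ec (k : R) (m : nat) : R :=
  (ln (k / 2) + euler_gamma) * jc k m - bessel_Y_coef m * (k ^ 2 / 4) ^ m.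

Lemma jc_entire (k : R) : 0 < k -> entire (jc k).
Proof.
  intros Hk. apply entire_dilate; [|apply bessel_coef_entire].
  assert (0 < k ^ 2) by (now apply pow_lt). lra.
Qed.

Lemma ec_entire (k : R) : 0 < k -> entire (ec k).
Proof.
  intros Hk. apply entire_minus; [apply entire_scal, jc_entire, Hk|].
  apply entire_dilate; [|apply bessel_Y_coef_entire].
  assert (0 < k ^ 2) by (now apply pow_lt). lra.
Qed.

Lemma dot2_nonneg (v : R2) : 0 <= dot2 v v.
Proof. unfold dot2. nra. Qed.

Lemma dot2_pos (v : R2) : v <> (0, 0) -> 0 < dot2 v v.
Proof.
  destruct v as [a b]. unfold dot2; simpl. intros H.
  destruct (Req_dec a 0) as [->|Ha]; [|nra].
  destruct (Req_dec b 0) as [->|Hb]; [now destruct H|nra].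
Qed.

Lemma sub2_neq (x y : R2) : x <> y -> sub2 x y <> (0, 0).
Proof.
  destruct x as [a b], y as [c d]. unfold sub2; simpl. intros H E. apply H.
  injection E as E1 E2. f_equal; lra.
Qed.

Lemma len2_sqr (v : R2) : len2 v ^ 2 = dot2 v v.
Proof. unfold len2. rewrite <- Rsqr_pow2. apply Rsqr_sqrt, dot2_nonneg. Qed.

Lemma ln_len2 (v : R2) : 0 < dot2 v v -> ln (len2 v) = / 2 * ln (dot2 v v).
Proof.
  intros H. rewrite <- len2_sqr. assert (0 < len2 v) by (apply sqrt_lt_R0, H).
  simpl. rewrite Rmult_1_r, ln_mult by lra. field.
Qed.

Lemma PSeries_dilate (a : nat -> R) (c x : R) :
  PSeries (fun m => a m * c ^ m) x = PSeries a (c * x).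
Proof. unfold PSeries. apply Series_ext. intros m. rewrite Rpow_mult_distr. ring. Qed.

Lemma hankel_radial (k : R) (v : R2) : 0 < k -> 0 < dot2 v v ->
  hankel_H0 (k * len2 v) =
  (PSeries (jc k) (dot2 v v),
   2 / PI * (/ 2 * ln (dot2 v v) * PSeries (jc k) (dot2 v v) + PSeries (ec k) (dot2 v v))).
Proof.
  intros Hk Hv.
  assert (E : (k * len2 v / 2) ^ 2 = k ^ 2 / 4 * dot2 v v).
  { rewrite <- len2_sqr. field. }
  assert (Hl : 0 < len2 v) by (apply sqrt_lt_R0, Hv).
  assert (EJ : bessel_J0 (k * len2 v) = PSeries (jc k) (dot2 v v)).
  { unfold bessel_J0. rewrite E. symmetry. exact (PSeries_dilate bessel_coef _ _). }
  assert (EY : bessel_Y0 (k * len2 v) = 2 / PI * (/ 2 * ln (dot2 v v) * PSeries (jc k) (dot2 v v)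
                 + PSeries (ec k) (dot2 v v))).
  { unfold bessel_Y0. rewrite EJ, E. f_equal.
    replace (k * len2 v / 2) with (k / 2 * len2 v) by field.
    rewrite ln_mult, ln_len2 by lra.
    change (PSeries _ (k ^ 2 / 4 * dot2 v v)) with (PSeries bessel_Y_coef (k ^ 2 / 4 * dot2 v v)).
    rewrite <- PSeries_dilate.
    assert (EE : PSeries (ec k) (dot2 v v) = (ln (k / 2) + euler_gamma) * PSeries (jc k) (dot2 v v)
      - PSeries (fun m => bessel_Y_coef m * (k ^ 2 / 4) ^ m) (dot2 v v)).
    { rewrite <- PSeries_scal, <- PSeries_minus.
      - reflexivity.
      - apply CV_radius_inside. rewrite entire_CV; [exact I|].
        apply entire_scal, jc_entire, Hk.
      - apply CV_radius_inside. rewrite entire_CV; [exact I|].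
        apply entire_dilate; [|apply bessel_Y_coef_entire].
        assert (0 < k ^ 2) by (now apply pow_lt). lra. }
    rewrite EE. ring. }
  unfold hankel_H0. rewrite EJ, EY. unfold Cplus, Cmult, Ci, RtoC; simpl. f_equal; ring.
Qed.

(** * Partial derivatives of real functions of the difference of two points *)

Definition rpartial (k : idx) (g : R2 -> R) (p : R2) : R :=
  match k with
  | i1 => Derive (fun s => g (s, snd p)) (fst p)
  | i2 => Derive (fun s => g (fst p, s)) (snd p)
  end.

(** [Derive] is total, so the sum, product and chain rules are proved for this relation, which also
    asserts that the derivative exists. *)
Definition is_rpartial (k : idx) (g : R2 -> R) (p : R2) (l : R) : Prop :=
  match k with
  | i1 => is_derive (fun s => g (s, snd p)) (fst p) l
  | i2 => is_derive (fun s => g (fst p, s)) (snd p) l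
  end.

Lemma is_rpartial_unique (k : idx) (g : R2 -> R) (p : R2) (l : R) :
  is_rpartial k g p l -> rpartial k g p = l.
Proof. destruct k; apply is_derive_unique. Qed.

Lemma Re_partial (k : idx) (f : R2 -> C) (p : R2) :
  Re (partial k f p) = rpartial k (fun q => Re (f q)) p.
Proof. now destruct k. Qed.

Lemma Im_partial (k : idx) (f : R2 -> C) (p : R2) :
  Im (partial k f p) = rpartial k (fun q => Im (f q)) p.
Proof. now destruct k. Qed.

Lemma locally_neq (x y : R) : x <> y -> locally x (fun s => s <> y).
Proof.
  intros H. assert (Hp : 0 < Rabs (x - y)) by (apply Rabs_pos_lt; lra).
  exists (mkposreal _ Hp). intros s Hs E. subst s.
  unfold ball in Hs; simpl in Hs; unfold AbsRing_ball in Hs; simpl in Hs.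
  unfold abs, minus, plus, opp in Hs; simpl in Hs.
  replace (y + - x) with (- (x - y)) in Hs by ring. rewrite Rabs_Ropp in Hs. lra.
Qed.

(** The kernels have their closed form only off the singular point [x]. A coordinate line through
    another point [p] either misses [x] entirely or avoids it near [p], according to the coordinate
    in which the two points differ. *)
Lemma is_rpartial_ext (k : idx) (g h : R2 -> R) (x p : R2) (l : R) :
  p <> x -> (forall q, q <> x -> g q = h q) -> is_rpartial k h p l -> is_rpartial k g p l.
Proof.
  intros Hp E H. destruct p as [p1 p2], x as [x1 x2].
  assert (D : p1 <> x1 \/ p2 <> x2).
  { destruct (Req_dec p1 x1) as [->|]; [|now left]. right. intros ->. now apply Hp. }
  destruct k; simpl in *; (eapply is_derive_ext_loc; [|exact H]); destruct D as [D|D].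
  - apply filter_imp with (2 := locally_neq _ _ D). intros s Hs. symmetry. apply E. congruence.
  - apply filter_forall. intros s. symmetry. apply E. congruence.
  - apply filter_forall. intros s. symmetry. apply E. congruence.
  - apply filter_imp with (2 := locally_neq _ _ D). intros s Hs. symmetry. apply E. congruence.
Qed.

Lemma is_rpartial_eq (k : idx) (g : R2 -> R) (p : R2) (l l' : R) :
  is_rpartial k g p l -> l = l' -> is_rpartial k g p l'.
Proof. now intros H <-. Qed.

Lemma is_rpartial_plus (k : idx) (g h : R2 -> R) (p : R2) (l m : R) :
  is_rpartial k g p l -> is_rpartial k h p m -> is_rpartial k (fun q => g q + h q) p (l + m).
Proof. destruct k; intros; now apply @is_derive_plus. Qed.

Lemma is_rpartial_mult (k : idx) (g h : R2 -> R) (p : R2) (l m : R) :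
  is_rpartial k g p l -> is_rpartial k h p m ->
  is_rpartial k (fun q => g q * h q) p (l * h p + g p * m).
Proof.
  destruct k, p as [p1 p2]; simpl; intros Hg Hh;
  [apply (is_derive_mult (fun s => g (s, p2)) (fun s => h (s, p2)))
  |apply (is_derive_mult (fun s => g (p1, s)) (fun s => h (p1, s)))];
  trivial; intros; apply Rmult_comm.
Qed.

Lemma is_rpartial_const (k : idx) (c : R) (p : R2) : is_rpartial k (fun _ => c) p 0.
Proof. destruct k; simpl; auto_derive; trivial. Qed.

Lemma is_rpartial_scal (k : idx) (c : R) (g : R2 -> R) (p : R2) (l : R) :
  is_rpartial k g p l -> is_rpartial k (fun q => c * g q) p (c * l).
Proof.
  intros H. eapply is_rpartial_eq; [apply is_rpartial_mult; [apply is_rpartial_const|exact H]|].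
  simpl. ring.
Qed.

Lemma is_rpartial_sub2_l (k i : idx) (y p : R2) :
  is_rpartial k (fun q => comp (sub2 q y) i) p (mxI i k).
Proof. destruct k, i; unfold mxI; simpl; auto_derive; trivial; ring. Qed.

Lemma is_rpartial_sub2_r (k i : idx) (x p : R2) :
  is_rpartial k (fun q => comp (sub2 x q) i) p (- mxI i k).
Proof. destruct k, i; unfold mxI; simpl; auto_derive; trivial; ring. Qed.

Lemma is_rpartial_radial_l (k : idx) (F : R -> R) (F' : R) (y p : R2) :
  is_derive F (dot2 (sub2 p y) (sub2 p y)) F' ->
  is_rpartial k (fun q => F (dot2 (sub2 q y) (sub2 q y))) p (2 * comp (sub2 p y) k * F').
Proof.
  intros H. destruct k, p as [p1 p2], y as [y1 y2]; unfold dot2, sub2 in *; simpl in *.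
  - apply (is_derive_comp F (fun s => (s - y1) * (s - y1) + (p2 - y2) * (p2 - y2))); trivial.
    auto_derive; trivial. ring.
  - apply (is_derive_comp F (fun s => (p1 - y1) * (p1 - y1) + (s - y2) * (s - y2))); trivial.
    auto_derive; trivial. ring.
Qed.

Lemma is_rpartial_radial_r (k : idx) (F : R -> R) (F' : R) (x p : R2) :
  is_derive F (dot2 (sub2 x p) (sub2 x p)) F' ->
  is_rpartial k (fun q => F (dot2 (sub2 x q) (sub2 x q))) p (- (2 * comp (sub2 x p) k * F')).
Proof.
  intros H. rewrite Ropp_mult_distr_l.
  destruct k, p as [p1 p2], x as [x1 x2]; unfold dot2, sub2 in *; simpl in *.
  - apply (is_derive_comp F (fun s => (x1 - s) * (x1 - s) + (x2 - p2) * (x2 - p2))); trivial.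
    auto_derive; trivial. ring.
  - apply (is_derive_comp F (fun s => (x1 - p1) * (x1 - p1) + (x2 - s) * (x2 - s))); trivial.
    auto_derive; trivial. ring.
Qed.

(** * Traction of isotropic tensors [al(|r|^2) I + be(|r|^2) r r^T] *)

Definition rtraction (lam mu : R) (n : R2) (u : R2 -> idx -> R) (p : R2) (i : idx) : R :=
  2 * mu * (fst n * rpartial i1 (fun q => u q i) p + snd n * rpartial i2 (fun q => u q i) p)
  + lam * (rpartial i1 (fun q => u q i1) p + rpartial i2 (fun q => u q i2) p) * comp n i
  - mu * comp (tangent n) i * (rpartial i1 (fun q => u q i2) p - rpartial i2 (fun q => u q i1) p).

Lemma Re_traction (lam mu : R) (n : R2) (u : R2 -> idx -> C) (p : R2) (i : idx) :
  Re (traction lam mu n u p i) = rtraction lam mu n (fun q k => Re (u q k)) p i.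
Proof.
  unfold rtraction. rewrite <- !Re_partial.
  unfold traction, normal_deriv, divergence, curl, Cplus, Cminus, Cplus, Copp, Cmult, RtoC, Re.
  simpl. ring.
Qed.

Lemma Im_traction (lam mu : R) (n : R2) (u : R2 -> idx -> C) (p : R2) (i : idx) :
  Im (traction lam mu n u p i) = rtraction lam mu n (fun q k => Im (u q k)) p i.
Proof.
  unfold rtraction. rewrite <- !Im_partial.
  unfold traction, normal_deriv, divergence, curl, Cplus, Cminus, Cplus, Copp, Cmult, RtoC, Im.
  simpl. ring.
Qed.

(* [al1], [be], [be1] are the values of [al'], [be], [be'] at [|r|^2], where [r = x - y]
   and the traction acts on [y]. *)
Definition radial_traction (lam mu : R) (n r : R2) (al1 be be1 : R) (i j : idx) : R :=
  - (2 * mu * (2 * al1 * dot2 n r * mxI i j + 2 * be1 * dot2 n r * (comp r i * comp r j)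
               + be * (comp n i * comp r j + comp n j * comp r i))
     + lam * comp n i * ((2 * al1 + 2 * be1 * dot2 r r + 3 * be) * comp r j)
     - mu * comp (tangent n) i * ((2 * al1 - be) * (fst r * mxI i2 j - snd r * mxI i1 j))).

Lemma rtraction_radial (lam mu : R) (n x y : R2) (K : R2 -> idx -> idx -> R)
    (al be : R -> R) (al1 be1 : R) (i j : idx) :
  x <> y ->
  (forall z k l, z <> x -> K z k l =
     al (dot2 (sub2 x z) (sub2 x z)) * mxI k l
     + be (dot2 (sub2 x z) (sub2 x z)) * (comp (sub2 x z) k * comp (sub2 x z) l)) ->
  is_derive al (dot2 (sub2 x y) (sub2 x y)) al1 ->
  is_derive be (dot2 (sub2 x y) (sub2 x y)) be1 ->
  rtraction lam mu n (fun z k => K z k j) y i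
  = radial_traction lam mu n (sub2 x y) al1 (be (dot2 (sub2 x y) (sub2 x y))) be1 i j.
Proof.
  intros Hxy HK Hal Hbe. set (r := sub2 x y) in *. set (rho := dot2 r r) in *.
  assert (P : forall m k l, rpartial m (fun z => K z k l) y =
    - (2 * comp r m * al1 * mxI k l + 2 * comp r m * be1 * (comp r k * comp r l)
       + be rho * (mxI k m * comp r l + comp r k * mxI l m))).
  { intros m k l. apply is_rpartial_unique.
    eapply is_rpartial_ext with (x := x); [congruence|intros q Hq; apply HK; exact Hq|].
    eapply is_rpartial_eq.
    - apply is_rpartial_plus; apply is_rpartial_mult;
        [apply is_rpartial_radial_r; exact Hal|apply is_rpartial_const
        |apply is_rpartial_radial_r; exact Hbe|].
      apply is_rpartial_mult; apply is_rpartial_sub2_r.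
    - cbv beta. fold r. fold rho. ring. }
  unfold rtraction. rewrite !P. unfold radial_traction.
  generalize (be rho). intros b. unfold dot2, mxI. destruct i, j; simpl; ring.
Qed.

Lemma radial_traction_linear (lam mu : R) (n r : R2) (c a1 b b1 a1' b' b1' : R) (i j : idx) :
  radial_traction lam mu n r (c * a1 + a1') (c * b + b') (c * b1 + b1') i j
  = c * radial_traction lam mu n r a1 b b1 i j + radial_traction lam mu n r a1' b' b1' i j.
Proof. unfold radial_traction. ring. Qed.

(** The inner derivative must be known as a function on the punctured plane, the outer one only at
    [x]; hence [f1] is given for all positive arguments, and [f2] is a single value. *)
Lemma is_rpartial_hessian (i j : idx) (x y : R2) (h : R2 -> R) (f f1 : R -> R) (f2 : R) :
  x <> y ->
  (forall z, z <> y -> h z = f (dot2 (sub2 z y) (sub2 z y))) ->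
  (forall t, 0 < t -> is_derive f t (f1 t)) ->
  is_derive f1 (dot2 (sub2 x y) (sub2 x y)) f2 ->
  rpartial i (rpartial j h) x
  = 4 * f2 * (comp (sub2 x y) i * comp (sub2 x y) j)
    + 2 * f1 (dot2 (sub2 x y) (sub2 x y)) * mxI i j.
Proof.
  intros Hxy Hh Hf Hf1. apply is_rpartial_unique.
  eapply is_rpartial_ext with (x := y)
    (h := fun z => 2 * comp (sub2 z y) j * f1 (dot2 (sub2 z y) (sub2 z y))); [exact Hxy| |].
  - intros z Hz. apply is_rpartial_unique.
    apply is_rpartial_ext with (x := y) (h := fun q => f (dot2 (sub2 q y) (sub2 q y))); trivial.
    apply is_rpartial_radial_l, Hf, dot2_pos, sub2_neq, Hz.
  - eapply is_rpartial_eq.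
    + apply is_rpartial_mult; [apply is_rpartial_scal, is_rpartial_sub2_l|].
      apply is_rpartial_radial_l, Hf1.
    + unfold mxI; destruct i, j; simpl; ring.
Qed.

(** In t = |r|^2 the Lame tensor has the profiles al = -(c/2) ln t and be = c a / t, since ln |r| =
    (ln t)/2. *)
Lemma traction_y_lame (lam mu : R) (n x y : R2) (i j : idx) :
  0 < mu -> 0 < lam + mu -> x <> y ->
  let c := (lam + 3 * mu) / (4 * PI * mu * (lam + 2 * mu)) in
  let a := (lam + mu) / (lam + 3 * mu) in
  let rho := dot2 (sub2 x y) (sub2 x y) in
  traction_y lam mu n (green_lame lam mu) x y i j
  = RtoC (radial_traction lam mu n (sub2 x y)
            (- c / (2 * rho)) (c * a / rho) (- c * a / rho ^ 2) i j).
Proof.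
  intros Hmu Hlam Hxy c a rho.
  assert (Hrho : 0 < rho) by apply dot2_pos, sub2_neq, Hxy.
  assert (HRe : Re (traction_y lam mu n (green_lame lam mu) x y i j) =
    radial_traction lam mu n (sub2 x y) (- c / (2 * rho)) (c * a / rho) (- c * a / rho ^ 2) i j).
  { unfold traction_y. rewrite Re_traction.
    apply (rtraction_radial lam mu n x y (fun z k l => Re (green_lame lam mu x z k l))
      (fun t => - c / 2 * ln t) (fun t => c * a / t)); trivial.
    - intros z k l Hz. assert (Hz' : 0 < dot2 (sub2 x z) (sub2 x z))
        by (apply dot2_pos, sub2_neq; congruence).
      unfold green_lame, Re, RtoC. cbv beta zeta delta [fst]. rewrite len2_sqr, ln_len2 by exact Hz'.
      fold c a. unfold outer. field. lra.
    - fold rho. auto_derive; [lra|]. field. lra.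
    - fold rho. auto_derive; [lra|]. field. lra. }
  assert (HIm : Im (traction_y lam mu n (green_lame lam mu) x y i j) = 0).
  { unfold traction_y. rewrite Im_traction. unfold rtraction.
    assert (Z : forall m k l, rpartial m (fun q => Im (green_lame lam mu x q k l)) y = 0).
    { intros. apply is_rpartial_unique. exact (is_rpartial_const m 0 y). }
    rewrite !Z. ring. }
  rewrite (surjective_pairing (traction_y _ _ _ _ _ _ _ _)).
  unfold RtoC. f_equal; assumption.
Qed.

Lemma traction_y_lame_formula (lam mu : R) (n x y : R2) (i j : idx) :
  0 < mu -> 0 < lam + mu -> x <> y ->
  traction_y lam mu n (green_lame lam mu) x y i j
  = RtoC (traction_lame_formula lam mu n x y i j).
Proof.
  intros Hmu Hlam Hxy. rewrite traction_y_lame by trivial. f_equal.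
  assert (Hrho : 0 < dot2 (sub2 x y) (sub2 x y)) by apply dot2_pos, sub2_neq, Hxy.
  unfold traction_lame_formula. cbv zeta.
  replace (len2 (sub2 x y) ^ 4) with ((len2 (sub2 x y) ^ 2) ^ 2) by ring. rewrite len2_sqr.
  unfold radial_traction, outer. destruct (sub2 x y) as [r1 r2], n as [n1 n2].
  pose proof PI_RGT_0. unfold dot2, tangent, mxI, mxL in *; simpl in *.
  destruct i, j; simpl; field; repeat split; lra.
Qed.

(* Coefficients [a] with J_0(k r) = 1 + r^2 a(r^2). *)
Definition jrem (k : R) : nat -> R := PS_decr_1 (jc k).
Definition jdiff (ks kp : R) (m : nat) : R := jc ks m - jc kp m.
(* Coefficients [a] with J_0(ks r) - J_0(kp r) = (kp^2 - ks^2) r^2 / 4 + r^4 a(r^2). *)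
Definition jdiff_rem (ks kp : R) : nat -> R := PS_decr_1 (PS_decr_1 (jdiff ks kp)).
Definition ediff (ks kp : R) (m : nat) : R := ec ks m - ec kp m.

Lemma jrem_entire (k : R) : 0 < k -> entire (jrem k).
Proof. intros. now apply entire_decr_1, jc_entire. Qed.

Lemma jdiff_entire (ks kp : R) : 0 < ks -> 0 < kp -> entire (jdiff ks kp).
Proof. intros. now apply entire_minus; apply jc_entire. Qed.

Lemma jdiff_rem_entire (ks kp : R) : 0 < ks -> 0 < kp -> entire (jdiff_rem ks kp).
Proof. intros. now apply entire_decr_1, entire_decr_1, jdiff_entire. Qed.

Lemma ediff_entire (ks kp : R) : 0 < ks -> 0 < kp -> entire (ediff ks kp).
Proof. intros. now apply entire_minus; apply ec_entire. Qed.

Lemma PSeries_jc (k t : R) : 0 < k -> PSeries (jc k) t = 1 + t * PSeries (jrem k) t.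
Proof.
  intros Hk. rewrite PSeries_entire_decr_1 by now apply jc_entire.
  f_equal. unfold jc, bessel_coef. simpl. field.
Qed.

Lemma PSeries_entire_minus (a b : nat -> R) (t : R) : entire a -> entire b ->
  PSeries (fun m => a m - b m) t = PSeries a t - PSeries b t.
Proof.
  intros Ha Hb. rewrite <- PSeries_minus; [reflexivity| |];
  apply CV_radius_inside; now rewrite entire_CV.
Qed.

Lemma PSeries_jdiff (ks kp t : R) : 0 < ks -> 0 < kp ->
  PSeries (jdiff ks kp) t = (kp ^ 2 - ks ^ 2) / 4 * t + t ^ 2 * PSeries (jdiff_rem ks kp) t.
Proof.
  intros Hs Hp. pose proof (jdiff_entire ks kp Hs Hp) as E.
  rewrite PSeries_entire_decr_1 by trivial.
  rewrite (PSeries_entire_decr_1 (PS_decr_1 (jdiff ks kp))) by now apply entire_decr_1.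
  change (PS_decr_1 (PS_decr_1 (jdiff ks kp))) with (jdiff_rem ks kp).
  unfold PS_decr_1 at 1, jdiff, jc, bessel_coef. simpl. field.
Qed.

(** * Derivatives of the radial profiles *)

Lemma is_derive_ext_R (f g : R -> R) (x l l' : R) :
  (forall t, f t = g t) -> is_derive f x l -> l = l' -> is_derive g x l'.
Proof. intros H D <-. now apply is_derive_ext with f. Qed.

(** Functions of the form (ln t)/2 times [f0] plus [e0] keep this form: the logarithmic factor is
    differentiated on its own, and the rest picks up f0 / (2t). Thus the logarithmic coefficient
    goes through the same operations as the imaginary part of the Green tensor. *)
Lemma is_derive_half_ln (f0 f1 e0 e1 : R -> R) (t : R) :
  0 < t -> is_derive f0 t (f1 t) -> is_derive e0 t (e1 t) ->
  is_derive (fun t => / 2 * ln t * f0 t + e0 t) t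
    (/ 2 * ln t * f1 t + (f0 t / (2 * t) + e1 t)).
Proof.
  intros Ht Hf He. auto_derive.
  - repeat split; trivial; [now exists (f1 t)|now exists (e1 t)].
  - replace (Derive (fun x => f0 x) t) with (f1 t) by (symmetry; now apply is_derive_unique).
    replace (Derive (fun x => e0 x) t) with (e1 t) by (symmetry; now apply is_derive_unique).
    field. lra.
Qed.

Lemma is_derive_quartic (c : R) (m : nat -> R) (t : R) : entire m ->
  is_derive (fun t => c * t + t ^ 2 * PSeries m t) t
    (c + (2 * t * PSeries m t + t ^ 2 * PSeries (PS_derive m) t)).
Proof.
  intros Hm. pose proof (is_derive_entire m t Hm) as D. auto_derive.
  - now exists (PSeries (PS_derive m) t).
  - replace (Derive (fun x => PSeries m x) t) with (PSeries (PS_derive m) t)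
      by (symmetry; now apply is_derive_unique). ring.
Qed.

(** The function is the non-logarithmic part after one use of [is_derive_half_ln] with f0 = c t +
    t^2 m(t); the division by 2t has been carried out. *)
Lemma is_derive_linear_part (c : R) (m e : nat -> R) (t : R) : entire m -> entire e ->
  is_derive (fun t => (c + t * PSeries m t) / 2 + PSeries e t) t
    ((PSeries m t + t * PSeries (PS_derive m) t) / 2 + PSeries (PS_derive e) t).
Proof.
  intros Hm He. pose proof (is_derive_entire m t Hm) as D.
  pose proof (is_derive_entire e t He) as D1. auto_derive.
  - repeat split; eexists; eassumption.
  - replace (Derive (fun x => PSeries m x) t) with (PSeries (PS_derive m) t)
      by (symmetry; now apply is_derive_unique).
    replace (Derive (fun x => PSeries e x) t) with (PSeries (PS_derive e) t)
      by (symmetry; now apply is_derive_unique). field.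
Qed.

(** The non-logarithmic part after two differentiations. The coefficient 3/2 is 1 from (2 t m) /
    (2t) plus 1/2 from the derivative of (t m) / 2; the term c / (2t) is the one that will match the
    Lame tensor. *)
Lemma is_derive_log_part (c : R) (m e : nat -> R) (t : R) : 0 < t -> entire m -> entire e ->
  is_derive (fun t => c / (2 * t) + 3 / 2 * PSeries m t + t * PSeries (PS_derive m) t
                      + PSeries e t) t
    (- c / (2 * t ^ 2) + 3 / 2 * PSeries (PS_derive m) t + PSeries (PS_derive m) t
     + t * PSeries (PS_derive (PS_derive m)) t + PSeries (PS_derive e) t).
Proof.
  intros Ht Hm He. pose proof (is_derive_entire m t Hm) as D.
  pose proof (is_derive_entire _ t (entire_derive m Hm)) as D1.
  pose proof (is_derive_entire e t He) as D2. auto_derive.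
  - repeat split; try (eexists; eassumption). lra.
  - replace (Derive (fun x => PSeries m x) t) with (PSeries (PS_derive m) t)
      by (symmetry; now apply is_derive_unique).
    replace (Derive (fun x => PSeries (PS_derive m) x) t) with (PSeries (PS_derive (PS_derive m)) t)
      by (symmetry; now apply is_derive_unique).
    replace (Derive (fun x => PSeries e x) t) with (PSeries (PS_derive e) t)
      by (symmetry; now apply is_derive_unique). field. lra.
Qed.

(** [quartic2] and [quartic3] are the second and third derivatives of c t + t^2 m(t), from which the
    constant [c] has dropped out. *)
Definition quartic2 (m : nat -> R) (t : R) : R :=
  2 * PSeries m t + 4 * t * PSeries (PS_derive m) t + t ^ 2 * PSeries (PS_derive (PS_derive m)) t.
Definition quartic3 (m : nat -> R) (t : R) : R :=
  6 * PSeries (PS_derive m) t + 6 * t * PSeries (PS_derive (PS_derive m)) t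
  + t ^ 2 * PSeries (PS_derive (PS_derive (PS_derive m))) t.

Lemma is_derive_quartic1 (c : R) (m : nat -> R) (t : R) : entire m ->
  is_derive (fun t => c + (2 * t * PSeries m t + t ^ 2 * PSeries (PS_derive m) t)) t (quartic2 m t).
Proof.
  intros Hm. pose proof (is_derive_entire m t Hm) as D.
  pose proof (is_derive_entire _ t (entire_derive m Hm)) as D1. auto_derive.
  - repeat split; [now exists (PSeries (PS_derive m) t)|now eexists; apply D1].
  - replace (Derive (fun x => PSeries m x) t) with (PSeries (PS_derive m) t)
      by (symmetry; now apply is_derive_unique).
    replace (Derive (fun x => PSeries (PS_derive m) x) t) with (PSeries (PS_derive (PS_derive m)) t)
      by (symmetry; now apply is_derive_unique). unfold quartic2. ring.
Qed.

Lemma is_derive_quartic2 (m : nat -> R) (t : R) : entire m ->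
  is_derive (quartic2 m) t (quartic3 m t).
Proof.
  intros Hm. pose proof (is_derive_entire m t Hm) as D.
  pose proof (is_derive_entire _ t (entire_derive m Hm)) as D1.
  pose proof (is_derive_entire _ t (entire_derive _ (entire_derive m Hm))) as D2.
  unfold quartic2. auto_derive.
  - repeat split; eexists; eassumption.
  - replace (Derive (fun x => PSeries m x) t) with (PSeries (PS_derive m) t)
      by (symmetry; now apply is_derive_unique).
    replace (Derive (fun x => PSeries (PS_derive m) x) t) with (PSeries (PS_derive (PS_derive m)) t)
      by (symmetry; now apply is_derive_unique).
    replace (Derive (fun x => PSeries (PS_derive (PS_derive m)) x) t)
      with (PSeries (PS_derive (PS_derive (PS_derive m))) t)
      by (symmetry; now apply is_derive_unique). unfold quartic3. ring.
Qed.

(** * Radial derivatives for the Green tensor of the Navier equation *)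

(* [al'], [be] and [be'] of the imaginary part of the Green tensor. *)
Definition im_al1 (mu ks kp t : R) : R :=
  1 / (4 * mu) * (PSeries (jrem ks) t + t * PSeries (PS_derive (jrem ks)) t
                  + 2 / ks ^ 2 * quartic2 (jdiff_rem ks kp) t).
Definition im_be (mu ks kp t : R) : R :=
  1 / (4 * mu) * (4 / ks ^ 2) * quartic2 (jdiff_rem ks kp) t.
Definition im_be1 (mu ks kp t : R) : R :=
  1 / (4 * mu) * (4 / ks ^ 2) * quartic3 (jdiff_rem ks kp) t.

(* What remains of the real part after removing [ln r] times the multiple [- 2 / PI] of the
   imaginary part and the Lame tensor; in the last coefficient,
   [rem_be1_reg t + rem_be1_sing t / t]. *)
Definition rem_al1 (mu ks kp t : R) : R :=
  - (1 / (2 * PI * mu)) *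
  (PSeries (jrem ks) t / 2 + PSeries (PS_derive (ec ks)) t
   + 2 / ks ^ 2 * (3 / 2 * PSeries (jdiff_rem ks kp) t + t * PSeries (PS_derive (jdiff_rem ks kp)) t
                   + PSeries (PS_derive (PS_derive (ediff ks kp))) t)).
Definition rem_be (mu ks kp t : R) : R :=
  - (1 / (2 * PI * mu)) * (4 / ks ^ 2) *
  (3 / 2 * PSeries (jdiff_rem ks kp) t + t * PSeries (PS_derive (jdiff_rem ks kp)) t
   + PSeries (PS_derive (PS_derive (ediff ks kp))) t).
Definition rem_be1_reg (mu ks kp t : R) : R :=
  - (1 / (2 * PI * mu)) * (4 / ks ^ 2) *
  (9 / 2 * PSeries (PS_derive (jdiff_rem ks kp)) t
   + 3 / 2 * t * PSeries (PS_derive (PS_derive (jdiff_rem ks kp))) t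
   + PSeries (PS_derive (PS_derive (PS_derive (ediff ks kp)))) t).
Definition rem_be1_sing (mu ks kp t : R) : R :=
  - (1 / (2 * PI * mu)) * (4 / ks ^ 2) * PSeries (jdiff_rem ks kp) t.

Lemma Re_Ci_div (a : R) (z : C) : a <> 0 -> Re (Ci / RtoC a * z)%C = - (1 / a) * Im z.
Proof. intros Ha. unfold Re, Im, Cdiv, Cmult, Cinv, Ci, RtoC; simpl. field. exact Ha. Qed.

Lemma Im_Ci_div (a : R) (z : C) : a <> 0 -> Im (Ci / RtoC a * z)%C = 1 / a * Re z.
Proof. intros Ha. unfold Re, Im, Cdiv, Cmult, Cinv, Ci, RtoC; simpl. field. exact Ha. Qed.

Lemma Re_partial2 (i j : idx) (h : R2 -> C) (x : R2) :
  Re (partial i (partial j h) x) = rpartial i (rpartial j (fun q => Re (h q))) x.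
Proof. rewrite Re_partial. now destruct j. Qed.

Lemma Im_partial2 (i j : idx) (h : R2 -> C) (x : R2) :
  Im (partial i (partial j h) x) = rpartial i (rpartial j (fun q => Im (h q))) x.
Proof. rewrite Im_partial. now destruct j. Qed.

Lemma is_derive_jc (k t : R) : 0 < k ->
  is_derive (PSeries (jc k)) t (PSeries (jrem k) t + t * PSeries (PS_derive (jrem k)) t).
Proof.
  intros Hk.
  apply is_derive_ext with (fun t => 1 + t * PSeries (jrem k) t).
  - intros; symmetry; now apply PSeries_jc.
  - pose proof (is_derive_entire _ t (jrem_entire k Hk)) as D. auto_derive.
    + now eexists; apply D.
    + replace (Derive (fun x => PSeries (jrem k) x) t) with (PSeries (PS_derive (jrem k)) t)
        by (symmetry; now apply is_derive_unique). ring.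
Qed.

(** Both sides equal rho omega^2. This is the only link between the wave numbers and the Lame
    constants, and the cancellation of the leading singularity rests on it. *)
Definition wave_number_relation (lam mu ks kp : R) : Prop :=
  kp ^ 2 * (lam + 2 * mu) = ks ^ 2 * mu.

Lemma wave_numbers (lam mu rho omega : R) :
  0 < mu -> 0 < lam + mu -> 0 < rho -> 0 < omega ->
  0 < wave_s mu rho omega /\ 0 < wave_p lam mu rho omega /\
  wave_number_relation lam mu (wave_s mu rho omega) (wave_p lam mu rho omega).
Proof.
  intros Hmu Hlam Hrho Hom. unfold wave_s, wave_p, wave_number_relation.
  assert (0 < rho / mu) by (apply Rdiv_lt_0_compat; lra).
  assert (0 < rho / (lam + 2 * mu)) by (apply Rdiv_lt_0_compat; lra).
  split; [|split].
  - apply Rmult_lt_0_compat; [trivial|now apply sqrt_lt_R0].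
  - apply Rmult_lt_0_compat; [trivial|now apply sqrt_lt_R0].
  - rewrite !Rpow_mult_distr, !pow2_sqrt by lra. field. lra.
Qed.

Lemma Im_green_navier (lam mu rho omega : R) (x z : R2) (i j : idx) :
  0 < mu -> 0 < lam + mu -> 0 < rho -> 0 < omega -> x <> z ->
  let ks := wave_s mu rho omega in
  let kp := wave_p lam mu rho omega in
  let r := sub2 x z in
  let t := dot2 r r in
  Im (green_navier lam mu rho omega x z i j) =
  1 / (4 * mu) * (PSeries (jc ks) t + 2 / ks ^ 2 *
     ((kp ^ 2 - ks ^ 2) / 4 + (2 * t * PSeries (jdiff_rem ks kp) t
                               + t ^ 2 * PSeries (PS_derive (jdiff_rem ks kp)) t))) * mxI i j
  + im_be mu ks kp t * (comp r i * comp r j).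
Proof.
  intros Hmu Hlam Hrho Hom Hxz ks kp r t.
  destruct (wave_numbers lam mu rho omega) as [Hs [Hp _]]; trivial. fold ks in Hs. fold kp in Hp.
  unfold green_navier. cbv zeta. fold ks kp. rewrite Im_Ci_div by lra.
  assert (Ht : 0 < t) by apply dot2_pos, sub2_neq, Hxz.
  pose proof (jdiff_rem_entire ks kp Hs Hp) as Em.
  assert (HR : forall a b : C, forall c d : R,
     Re (a * RtoC c + RtoC d * b)%C = Re a * c + d * Re b)
    by (intros; unfold Re, Cplus, Cmult, RtoC; simpl; ring).
  rewrite HR, Re_partial2, hankel_radial by trivial. unfold Re at 1, fst at 1. fold r t.
  rewrite (is_rpartial_hessian i j x z _
    (fun t => (kp ^ 2 - ks ^ 2) / 4 * t + t ^ 2 * PSeries (jdiff_rem ks kp) t)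
    (fun t => (kp ^ 2 - ks ^ 2) / 4 + (2 * t * PSeries (jdiff_rem ks kp) t
                               + t ^ 2 * PSeries (PS_derive (jdiff_rem ks kp)) t))
    (quartic2 (jdiff_rem ks kp) t)); trivial.
  - fold r t. unfold im_be. field. lra.
  - intros q Hq. assert (Hq' := dot2_pos _ (sub2_neq _ _ Hq)).
    cbv beta. rewrite (hankel_radial ks), (hankel_radial kp) by trivial.
    rewrite <- PSeries_jdiff by trivial. unfold jdiff.
    rewrite PSeries_entire_minus by now apply jc_entire. simpl. ring.
  - intros; now apply is_derive_quartic.
  - now apply is_derive_quartic1.
Qed.

(** The factor i in front exchanges the roles of J_0 and Y_0, so the logarithm appears here, with
    constant -(1/(4 mu)) (2/pi). The factors 2 / ks^2 and 4 / ks^2 come from the Hessian 4 f'' r r^T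
    + 2 f' I of a radial function. *)
Lemma Re_green_navier (lam mu rho omega : R) (x z : R2) (i j : idx) :
  0 < mu -> 0 < lam + mu -> 0 < rho -> 0 < omega -> x <> z ->
  let ks := wave_s mu rho omega in
  let kp := wave_p lam mu rho omega in
  let m := jdiff_rem ks kp in
  let c := (kp ^ 2 - ks ^ 2) / 4 in
  let r := sub2 x z in
  let t := dot2 r r in
  Re (green_navier lam mu rho omega x z i j) =
  - (1 / (2 * PI * mu)) * (/ 2 * ln t * PSeries (jc ks) t + PSeries (ec ks) t + 2 / ks ^ 2 *
     (/ 2 * ln t * (c + (2 * t * PSeries m t + t ^ 2 * PSeries (PS_derive m) t))
      + ((c + t * PSeries m t) / 2 + PSeries (PS_derive (ediff ks kp)) t))) * mxI i j
  + - (1 / (2 * PI * mu)) * (4 / ks ^ 2) *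
    (/ 2 * ln t * quartic2 m t
     + (c / (2 * t) + 3 / 2 * PSeries m t + t * PSeries (PS_derive m) t
        + PSeries (PS_derive (PS_derive (ediff ks kp))) t)) * (comp r i * comp r j).
Proof.
  intros Hmu Hlam Hrho Hom Hxz ks kp m c r t.
  destruct (wave_numbers lam mu rho omega) as [Hs [Hp _]]; trivial. fold ks in Hs. fold kp in Hp.
  unfold green_navier. cbv zeta. fold ks kp. rewrite Re_Ci_div by lra.
  assert (Ht : 0 < t) by apply dot2_pos, sub2_neq, Hxz.
  pose proof (jdiff_rem_entire ks kp Hs Hp) as Em. fold m in Em.
  pose proof (ediff_entire ks kp Hs Hp) as Ee.
  pose proof PI_RGT_0 as HPI.
  assert (HI : forall a b : C, forall c d : R,
     Im (a * RtoC c + RtoC d * b)%C = Im a * c + d * Im b)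
    by (intros; unfold Im, Cplus, Cmult, RtoC; simpl; ring).
  rewrite HI, Im_partial2, hankel_radial by trivial. unfold Im at 1, snd at 1. fold r t.
  set (f1 := fun t => / 2 * ln t * (c + (2 * t * PSeries m t + t ^ 2 * PSeries (PS_derive m) t))
      + ((c + t * PSeries m t) / 2 + PSeries (PS_derive (ediff ks kp)) t)).
  set (f2 := / 2 * ln t * quartic2 m t
     + (c / (2 * t) + 3 / 2 * PSeries m t + t * PSeries (PS_derive m) t
        + PSeries (PS_derive (PS_derive (ediff ks kp))) t)).
  rewrite (is_rpartial_hessian i j x z _
    (fun t => 2 / PI * (/ 2 * ln t * (c * t + t ^ 2 * PSeries m t) + PSeries (ediff ks kp) t))
    (fun t => 2 / PI * f1 t) (2 / PI * f2)); trivial.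
  - fold r t. unfold f1. field. lra.
  - intros q Hq. assert (Hq' := dot2_pos _ (sub2_neq _ _ Hq)).
    cbv beta. rewrite (hankel_radial ks), (hankel_radial kp) by trivial. unfold c, m.
    rewrite <- PSeries_jdiff by trivial. unfold jdiff, ediff.
    rewrite !PSeries_entire_minus by (now apply jc_entire || now apply ec_entire). simpl. ring.
  - intros s Hs'. apply @is_derive_scal.
    eapply is_derive_ext_R; [reflexivity| |].
    + apply (is_derive_half_ln (fun t => c * t + t ^ 2 * PSeries m t)
        (fun t => c + (2 * t * PSeries m t + t ^ 2 * PSeries (PS_derive m) t))
        (PSeries (ediff ks kp))
        (PSeries (PS_derive (ediff ks kp))) s Hs').
      * now apply (is_derive_quartic c m).
      * now apply is_derive_entire.
    + unfold f1. field. lra.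
  - fold r t. apply @is_derive_scal.
    eapply is_derive_ext_R; [reflexivity| |].
    + apply (is_derive_half_ln
        (fun t => c + (2 * t * PSeries m t + t ^ 2 * PSeries (PS_derive m) t))
        (quartic2 m)
        (fun t => (c + t * PSeries m t) / 2 + PSeries (PS_derive (ediff ks kp)) t)
        (fun t => (PSeries m t + t * PSeries (PS_derive m) t) / 2
                  + PSeries (PS_derive (PS_derive (ediff ks kp))) t) t Ht).
      * now apply is_derive_quartic1.
      * now apply is_derive_linear_part, entire_derive.
    + unfold f2. field. lra.
Qed.

Lemma Im_traction_navier (lam mu rho omega : R) (n x y : R2) (i j : idx) :
  0 < mu -> 0 < lam + mu -> 0 < rho -> 0 < omega -> x <> y ->
  let ks := wave_s mu rho omega in
  let kp := wave_p lam mu rho omega in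
  let r := sub2 x y in
  let t := dot2 r r in
  Im (traction_y lam mu n (green_navier lam mu rho omega) x y i j)
  = radial_traction lam mu n r (im_al1 mu ks kp t) (im_be mu ks kp t) (im_be1 mu ks kp t) i j.
Proof.
  intros Hmu Hlam Hrho Hom Hxy ks kp r t.
  destruct (wave_numbers lam mu rho omega) as [Hs [Hp _]]; trivial. fold ks in Hs. fold kp in Hp.
  pose proof (jdiff_rem_entire ks kp Hs Hp) as Em.
  unfold traction_y. rewrite Im_traction.
  apply (rtraction_radial lam mu n x y (fun z k l => Im (green_navier lam mu rho omega x z k l))
    (fun t => 1 / (4 * mu) * (PSeries (jc ks) t + 2 / ks ^ 2 *
     ((kp ^ 2 - ks ^ 2) / 4 + (2 * t * PSeries (jdiff_rem ks kp) t
                               + t ^ 2 * PSeries (PS_derive (jdiff_rem ks kp)) t))))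
    (im_be mu ks kp)); trivial.
  - intros z k l Hz. apply Im_green_navier; trivial. congruence.
  - apply @is_derive_scal. apply @is_derive_plus; [now apply is_derive_jc|].
    apply @is_derive_scal. now apply is_derive_quartic1.
  - apply @is_derive_scal. now apply is_derive_quartic2.
Qed.

(** All three tractions are the same linear form in radial coefficients, so it suffices to split the
    coefficients. The terms with [c] and the leading 1 of J_0 yield exactly the coefficients of the
    Lame tensor. *)
Lemma Re_traction_navier (lam mu rho omega : R) (n x y : R2) (i j : idx) :
  0 < mu -> 0 < lam + mu -> 0 < rho -> 0 < omega -> x <> y ->
  let ks := wave_s mu rho omega in
  let kp := wave_p lam mu rho omega in
  let r := sub2 x y in
  let t := dot2 r r in
  Re (traction_y lam mu n (green_navier lam mu rho omega) x y i j)
  = Re (traction_y lam mu n (green_lame lam mu) x y i j)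
    + ln (len2 r) * (- (2 / PI)
        * Im (traction_y lam mu n (green_navier lam mu rho omega) x y i j))
    + radial_traction lam mu n r (rem_al1 mu ks kp t) (rem_be mu ks kp t)
        (rem_be1_reg mu ks kp t + rem_be1_sing mu ks kp t / t) i j.
Proof.
  intros Hmu Hlam Hrho Hom Hxy ks kp r t.
  rewrite Im_traction_navier by trivial. fold ks kp r t.
  rewrite traction_y_lame by trivial. fold r t.
  match goal with |- context [Re (RtoC ?v)] => change (Re (RtoC v)) with v end.
  destruct (wave_numbers lam mu rho omega) as [Hs [Hp W]]; trivial. fold ks in Hs. fold kp in Hp.
  fold ks kp in W. unfold wave_number_relation in W.
  assert (Ht : 0 < t) by apply dot2_pos, sub2_neq, Hxy.
  pose proof (jdiff_rem_entire ks kp Hs Hp) as Em.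
  pose proof (ediff_entire ks kp Hs Hp) as Ee.
  pose proof (ec_entire ks Hs) as Es.
  pose proof PI_RGT_0 as HPI.
  rewrite ln_len2 by exact Ht. fold t.
  set (m := jdiff_rem ks kp) in *. set (c := (kp ^ 2 - ks ^ 2) / 4).
  unfold traction_y. rewrite Re_traction.
  rewrite (rtraction_radial lam mu n x y (fun z k l => Re (green_navier lam mu rho omega x z k l))
    (fun t => - (1 / (2 * PI * mu)) *
     (/ 2 * ln t * PSeries (jc ks) t + PSeries (ec ks) t + 2 / ks ^ 2 *
     (/ 2 * ln t * (c + (2 * t * PSeries m t + t ^ 2 * PSeries (PS_derive m) t))
      + ((c + t * PSeries m t) / 2 + PSeries (PS_derive (ediff ks kp)) t))))
    (fun t => - (1 / (2 * PI * mu)) * (4 / ks ^ 2) *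
    (/ 2 * ln t * quartic2 m t
     + (c / (2 * t) + 3 / 2 * PSeries m t + t * PSeries (PS_derive m) t
        + PSeries (PS_derive (PS_derive (ediff ks kp))) t)))
    (- (1 / (2 * PI * mu)) *
      ((/ 2 * ln t * (PSeries (jrem ks) t + t * PSeries (PS_derive (jrem ks)) t)
        + (PSeries (jc ks) t / (2 * t) + PSeries (PS_derive (ec ks)) t)) + 2 / ks ^ 2 *
       (/ 2 * ln t * quartic2 m t
        + ((c + (2 * t * PSeries m t + t ^ 2 * PSeries (PS_derive m) t)) / (2 * t)
           + ((PSeries m t + t * PSeries (PS_derive m) t) / 2
              + PSeries (PS_derive (PS_derive (ediff ks kp))) t)))))
    (- (1 / (2 * PI * mu)) * (4 / ks ^ 2) *
      (/ 2 * ln t * quartic3 m t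
       + (quartic2 m t / (2 * t)
          + (- c / (2 * t ^ 2) + 3 / 2 * PSeries (PS_derive m) t + PSeries (PS_derive m) t
             + t * PSeries (PS_derive (PS_derive m)) t
             + PSeries (PS_derive (PS_derive (PS_derive (ediff ks kp)))) t)))));
    trivial.
  - fold r t.
    set (A := (lam + 3 * mu) / (4 * PI * mu * (lam + 2 * mu))).
    set (B := (lam + mu) / (lam + 3 * mu)).
    (* Each coefficient is arranged as logarithm, Lame part and rest, in the shape to which
       [radial_traction_linear] applies twice; the factor 1 is there for that shape. *)
    transitivity (radial_traction lam mu n r
      (/ 2 * ln t * - (2 / PI) * im_al1 mu ks kp t + (1 * (- A / (2 * t)) + rem_al1 mu ks kp t))
      (/ 2 * ln t * - (2 / PI) * im_be mu ks kp t + (1 * (A * B / t) + rem_be mu ks kp t))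
      (/ 2 * ln t * - (2 / PI) * im_be1 mu ks kp t
       + (1 * (- A * B / t ^ 2) + (rem_be1_reg mu ks kp t + rem_be1_sing mu ks kp t / t))) i j);
      [|rewrite !radial_traction_linear; ring].
    (* The wave number relation eliminates [kp]. After division by ks^2 only Lame constants are left
       in the terms with [c]. *)
    assert (Hc : c = - ks ^ 2 * (lam + mu) / (4 * (lam + 2 * mu))).
    { unfold c. apply Rmult_eq_reg_r with (4 * (lam + 2 * mu)); [|lra].
      field_simplify; [|lra..]. lra. }
    f_equal.
    + unfold im_al1, rem_al1, A. rewrite PSeries_jc by trivial. rewrite Hc. fold m.
      field. lra.
    + unfold im_be, rem_be, A, B. rewrite Hc. fold m. field. lra.
    (* The quotient quartic2 / (2t) contributes m / t, 2 m' and t m'' / 2. The first is the singular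
       coefficient; the others join 5/2 m' and t m'' to give 9/2 and 3/2. *)
    + unfold im_be1, rem_be1_reg, rem_be1_sing, quartic2, A, B. rewrite Hc. fold m. field. lra.
  - intros z k l Hz. rewrite Re_green_navier; trivial. congruence.
  - fold r t. apply @is_derive_scal. apply @is_derive_plus.
    + apply (is_derive_half_ln (PSeries (jc ks))
        (fun t => PSeries (jrem ks) t + t * PSeries (PS_derive (jrem ks)) t)
        (PSeries (ec ks)) (PSeries (PS_derive (ec ks)))); trivial.
      * now apply is_derive_jc.
      * now apply is_derive_entire.
    + apply @is_derive_scal. apply (is_derive_half_ln
        (fun t => c + (2 * t * PSeries m t + t ^ 2 * PSeries (PS_derive m) t)) (quartic2 m)
        (fun t => (c + t * PSeries m t) / 2 + PSeries (PS_derive (ediff ks kp)) t)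
        (fun t => (PSeries m t + t * PSeries (PS_derive m) t) / 2
                  + PSeries (PS_derive (PS_derive (ediff ks kp))) t)); trivial.
      * now apply is_derive_quartic1.
      * now apply is_derive_linear_part, entire_derive.
  - fold r t. apply @is_derive_scal. apply (is_derive_half_ln (quartic2 m) (quartic3 m)
      (fun t => c / (2 * t) + 3 / 2 * PSeries m t + t * PSeries (PS_derive m) t
                + PSeries (PS_derive (PS_derive (ediff ks kp))) t)
      (fun t => - c / (2 * t ^ 2) + 3 / 2 * PSeries (PS_derive m) t + PSeries (PS_derive m) t
                + t * PSeries (PS_derive (PS_derive m)) t
                + PSeries (PS_derive (PS_derive (PS_derive (ediff ks kp)))) t)); trivial.
    + now apply is_derive_quartic2.
    + apply is_derive_log_part; trivial. now apply entire_derive, entire_derive.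
Qed.

(** * The remainder near the diagonal *)

Lemma Rabs_plus_le (a b A B : R) : Rabs a <= A -> Rabs b <= B -> Rabs (a + b) <= A + B.
Proof. intros. pose proof (Rabs_triang a b). lra. Qed.

Lemma Rabs_opp_le (a A : R) : Rabs a <= A -> Rabs (- a) <= A.
Proof. now rewrite Rabs_Ropp. Qed.

Lemma Rabs_mult_le (a b A B : R) : Rabs a <= A -> Rabs b <= B -> Rabs (a * b) <= A * B.
Proof. intros. rewrite Rabs_mult. apply Rmult_le_compat; trivial; apply Rabs_pos. Qed.

Lemma Rabs_mxI (i j : idx) : Rabs (mxI i j) <= 1.
Proof. destruct i, j; unfold mxI; simpl; rewrite ?Rabs_R0, ?Rabs_R1; lra. Qed.

(** The coefficient [b1] always comes with r_i r_j or |r|^2, and |r_i r_j| <= |r|^2, so only |r|^2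
    [b1] has to be bounded and a singularity of order |r|^-2 in [b1] is allowed. A further component
    of r remains as a factor. The 8 exceeds every numerical coefficient that arises. *)
Lemma radial_traction_bound (lam mu : R) (n : R2) :
  exists K, 0 <= K /\ forall r a b b1 i j,
    Rabs (radial_traction lam mu n r a b b1 i j)
    <= K * (Rabs a + Rabs b + Rabs (dot2 r r * b1)) * (Rabs (fst r) + Rabs (snd r)).
Proof.
  set (N := Rabs (fst n) + Rabs (snd n)).
  assert (HN : 0 <= N)
    by (unfold N; pose proof (Rabs_pos (fst n)); pose proof (Rabs_pos (snd n)); lra).
  pose proof (Rabs_pos lam) as Hl. pose proof (Rabs_pos mu) as Hm.
  exists (8 * (Rabs lam + Rabs mu) * N).
  split; [repeat apply Rmult_le_pos; lra|].
  intros r a b b1 i j. set (s := Rabs (fst r) + Rabs (snd r)).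
  pose proof (Rabs_pos (fst r)) as P1. pose proof (Rabs_pos (snd r)) as P2.
  pose proof (Rabs_pos (fst n)) as P3. pose proof (Rabs_pos (snd n)) as P4.
  assert (Hs : 0 <= s) by (unfold s; lra).
  assert (Hri : forall k, Rabs (comp r k) <= s) by (intros []; simpl; unfold s; lra).
  assert (Hr1 := Hri i1). assert (Hr2 := Hri i2). simpl in Hr1, Hr2.
  assert (Hni : forall k, Rabs (comp n k) <= N) by (intros []; simpl; unfold N; lra).
  assert (Hti : Rabs (comp (tangent n) i) <= N)
    by (destruct i; unfold tangent; simpl; rewrite ?Rabs_Ropp; unfold N; lra).
  assert (Hnr : Rabs (dot2 n r) <= N * s).
  { unfold dot2. eapply Rle_trans; [apply Rabs_triang|]. rewrite !Rabs_mult.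
    unfold N, s. nra. }
  assert (Hrr : Rabs (b1 * (comp r i * comp r j)) <= Rabs (dot2 r r * b1)).
  { rewrite !Rabs_mult, (Rmult_comm _ (Rabs b1)). apply Rmult_le_compat_l; [apply Rabs_pos|].
    rewrite <- Rabs_mult, (Rabs_pos_eq (dot2 r r)) by apply dot2_nonneg.
    unfold dot2. apply Rabs_le. destruct i, j; simpl; nra. }
  assert (Hd : Rabs (fst r * mxI i2 j - snd r * mxI i1 j) <= s).
  { destruct j; unfold mxI; simpl;
      [replace (fst r * 0 - snd r * 1) with (- snd r) by ring
      |replace (fst r * 1 - snd r * 0) with (fst r) by ring];
      rewrite ?Rabs_Ropp; trivial. }
  pose proof (Rabs_mxI i j) as HI.
  assert (H2 : Rabs 2 <= 2) by (rewrite Rabs_pos_eq; lra).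
  assert (H3 : Rabs 3 <= 3) by (rewrite Rabs_pos_eq; lra).
  unfold radial_traction.
  replace (2 * b1 * dot2 n r * (comp r i * comp r j))
    with (2 * dot2 n r * (b1 * (comp r i * comp r j))) by ring.
  replace (2 * b1 * dot2 r r) with (2 * (dot2 r r * b1)) by ring.
  generalize dependent (b1 * (comp r i * comp r j)). intros q Hq.
  generalize dependent (dot2 r r * b1). intros p Hp.
  unfold Rminus in *.
  pose proof (Rabs_pos a). pose proof (Rabs_pos b). pose proof (Rabs_pos p).
  eapply Rle_trans.
  (* The intermediate bound is left open and assembled from the syntax: sums give sums of bounds,
     products give products. *)
  - repeat first
      [ apply Hri | apply Hni | eassumption | apply Rabs_opp_le
      | apply Rabs_plus_le | apply Rabs_mult_le | apply Rle_refl ].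
  - match goal with |- ?L <= _ =>
      replace L with ((Rabs mu * (6 * Rabs a + 4 * Rabs p + 5 * Rabs b)
                      + Rabs lam * (2 * Rabs a + 2 * Rabs p + 3 * Rabs b)) * (N * s)) by ring end.
    replace (8 * (Rabs lam + Rabs mu) * N * (Rabs a + Rabs b + Rabs p) * s)
      with (8 * (Rabs lam + Rabs mu) * (Rabs a + Rabs b + Rabs p) * (N * s)) by ring.
    apply Rmult_le_compat_r; [now apply Rmult_le_pos|].
    assert (0 <= Rabs mu * Rabs a) by now apply Rmult_le_pos.
    assert (0 <= Rabs mu * Rabs b) by now apply Rmult_le_pos.
    assert (0 <= Rabs mu * Rabs p) by now apply Rmult_le_pos.
    assert (0 <= Rabs lam * Rabs a) by now apply Rmult_le_pos.
    assert (0 <= Rabs lam * Rabs b) by now apply Rmult_le_pos.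
    assert (0 <= Rabs lam * Rabs p) by now apply Rmult_le_pos.
    lra.
Qed.

Definition bounded1 (f : R -> R) : Prop := exists M, forall t, Rabs t <= 1 -> Rabs (f t) <= M.

Lemma bounded1_plus (f g : R -> R) : bounded1 f -> bounded1 g -> bounded1 (fun t => f t + g t).
Proof. intros [M H] [N K]. exists (M + N). intros. apply Rabs_plus_le; auto. Qed.

Lemma bounded1_mult (f g : R -> R) : bounded1 f -> bounded1 g -> bounded1 (fun t => f t * g t).
Proof. intros [M H] [N K]. exists (M * N). intros. apply Rabs_mult_le; auto. Qed.

Lemma bounded1_const (c : R) : bounded1 (fun _ => c).
Proof. exists (Rabs c). intros; lra. Qed.

Lemma bounded1_id : bounded1 (fun t => t).
Proof. now exists 1. Qed.

Lemma bounded1_PSeries (a : nat -> R) : entire a -> bounded1 (fun t => PSeries a t).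
Proof. apply PSeries_entire_bounded. Qed.

Ltac bounded1_tac :=
  repeat first [ apply bounded1_const | apply bounded1_id | apply bounded1_plus
               | apply bounded1_mult | apply bounded1_PSeries ].

Ltac entire_tac := repeat apply entire_derive; first
  [ now apply jrem_entire | now apply jdiff_rem_entire | now apply ediff_entire | now apply ec_entire ].

Lemma radial_traction_vanishes (lam mu : R) (n : R2) (a b b1 : R -> R) (i j : idx) :
  bounded1 a -> bounded1 b -> bounded1 (fun t => t * b1 t) ->
  forall eps, 0 < eps -> exists d, 0 < d /\ forall r,
    Rabs (fst r) < d -> Rabs (snd r) < d ->
    Rabs (radial_traction lam mu n r (a (dot2 r r)) (b (dot2 r r)) (b1 (dot2 r r)) i j) < eps.
Proof.
  intros [Ma Ha] [Mb Hb] [Mc Hc] eps He.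
  destruct (radial_traction_bound lam mu n) as [K [HK B]].
  assert (Z : Rabs 0 <= 1) by (rewrite Rabs_R0; lra).
  assert (0 <= Ma) by (eapply Rle_trans; [apply Rabs_pos|now apply (Ha 0)]).
  assert (0 <= Mb) by (eapply Rle_trans; [apply Rabs_pos|now apply (Hb 0)]).
  assert (0 <= Mc) by (eapply Rle_trans; [apply Rabs_pos|now apply (Hc 0)]).
  set (L := K * (Ma + Mb + Mc)).
  assert (HL : 0 <= L) by (apply Rmult_le_pos; lra).
  (* The bound 1/2 keeps |r|^2 at most 1, where the coefficients are bounded. The second bound
     shares [eps] between the two coordinates; [L + 1] is positive even when [L = 0]. *)
  exists (Rmin (/ 2) (eps / (2 * (L + 1)))).
  assert (Hq : 0 < eps / (2 * (L + 1))) by (apply Rdiv_lt_0_compat; lra).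
  split; [apply Rmin_glb_lt; lra|]. intros r Hr1 Hr2.
  pose proof (Rmin_l (/ 2) (eps / (2 * (L + 1)))). pose proof (Rmin_r (/ 2) (eps / (2 * (L + 1)))).
  pose proof (Rabs_pos (fst r)). pose proof (Rabs_pos (snd r)).
  assert (T : Rabs (dot2 r r) <= 1).
  { unfold dot2. eapply Rle_trans; [apply Rabs_triang|]. rewrite !Rabs_mult. nra. }
  eapply Rle_lt_trans; [apply B|].
  apply Rle_lt_trans with (L * (Rabs (fst r) + Rabs (snd r))).
  - apply Rmult_le_compat_r; [lra|]. apply Rmult_le_compat_l; trivial.
    specialize (Ha _ T). specialize (Hb _ T). specialize (Hc _ T). lra.
  - apply Rle_lt_trans with (L * (eps / (L + 1))).
    + apply Rmult_le_compat_l; trivial.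
      replace (eps / (L + 1)) with (2 * (eps / (2 * (L + 1)))) by (field; lra). lra.
    + apply Rmult_lt_reg_r with (L + 1); [lra|].
      replace (L * (eps / (L + 1)) * (L + 1)) with (L * eps) by (field; lra). nra.
Qed.

(** The indices are exchanged because the kernel is the transpose of the traction. The second
    component is the full imaginary part of the traction of G, the other terms of the decomposition
    being real. *)
Definition remainder (lam mu ks kp : R) (n r : R2) (i j : idx) : C :=
  let t := dot2 r r in
  (radial_traction lam mu n r (rem_al1 mu ks kp t) (rem_be mu ks kp t)
     (rem_be1_reg mu ks kp t + rem_be1_sing mu ks kp t / t) j i,
   radial_traction lam mu n r (im_al1 mu ks kp t) (im_be mu ks kp t) (im_be1 mu ks kp t) j i).

Lemma remainder_vanishes (lam mu ks kp : R) (n y : R2) (D : R2 -> Prop) (i j : idx) :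
  0 < ks -> 0 < kp -> (forall x, D x -> x <> y) ->
  filterlim (fun x => remainder lam mu ks kp n (sub2 x y) i j) (within D (locally y))
    (locally (RtoC 0)).
Proof.
  intros Hs Hp HD. apply filterlim_locally. intros eps.
  destruct (radial_traction_vanishes lam mu n (im_al1 mu ks kp) (im_be mu ks kp)
    (im_be1 mu ks kp) j i) with (eps := pos eps) as [d1 [Hd1 H1]]; try apply cond_pos.
  { unfold im_al1, quartic2, Rdiv. simpl pow. bounded1_tac; entire_tac. }
  { unfold im_be, quartic2, Rdiv. simpl pow. bounded1_tac; entire_tac. }
  { unfold im_be1, quartic3, Rdiv. simpl pow. bounded1_tac; entire_tac. }
  (* The singular coefficient is given the value 0 at t = 0; the points considered have [x <> y],
     hence t > 0. *)
  destruct (radial_traction_vanishes lam mu n (rem_al1 mu ks kp) (rem_be mu ks kp)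
    (fun t => if Req_EM_T t 0 then 0
              else rem_be1_reg mu ks kp t + rem_be1_sing mu ks kp t / t) j i)
    with (eps := pos eps) as [d2 [Hd2 H2]]; try apply cond_pos.
  { unfold rem_al1, Rdiv. bounded1_tac; entire_tac. }
  { unfold rem_be, Rdiv. bounded1_tac; entire_tac. }
  { assert (Bd : bounded1 (fun t => t * rem_be1_reg mu ks kp t + rem_be1_sing mu ks kp t))
      by (unfold rem_be1_reg, rem_be1_sing, Rdiv; bounded1_tac; entire_tac).
    destruct Bd as [M HM]. exists M. intros t Ht. destruct (Req_EM_T t 0) as [|Hnz].
    - rewrite Rmult_0_r, Rabs_R0. eapply Rle_trans; [apply Rabs_pos|now apply (HM t)].
    - replace (t * (rem_be1_reg mu ks kp t + rem_be1_sing mu ks kp t / t))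
        with (t * rem_be1_reg mu ks kp t + rem_be1_sing mu ks kp t) by (field; exact Hnz).
      now apply HM. }
  assert (Hd : 0 < Rmin d1 d2) by now apply Rmin_glb_lt.
  pose proof (Rmin_l d1 d2) as Hm1. pose proof (Rmin_r d1 d2) as Hm2.
  exists (mkposreal _ Hd). intros x [Hx1 Hx2] HDx.
  change (Rabs (fst x - fst y) < Rmin d1 d2) in Hx1.
  change (Rabs (snd x - snd y) < Rmin d1 d2) in Hx2.
  specialize (H1 (sub2 x y) (Rlt_le_trans _ _ _ Hx1 Hm1) (Rlt_le_trans _ _ _ Hx2 Hm1)).
  specialize (H2 (sub2 x y) (Rlt_le_trans _ _ _ Hx1 Hm2) (Rlt_le_trans _ _ _ Hx2 Hm2)).
  assert (Hnz : 0 < dot2 (sub2 x y) (sub2 x y)) by (apply dot2_pos, sub2_neq, HD, HDx).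
  destruct (Req_EM_T (dot2 (sub2 x y) (sub2 x y)) 0) as [|_]; [lra|].
  split.
  - change (Rabs (fst (remainder lam mu ks kp n (sub2 x y) i j) - 0) < eps).
    rewrite Rminus_0_r. exact H2.
  - change (Rabs (snd (remainder lam mu ks kp n (sub2 x y) i j) - 0) < eps).
    rewrite Rminus_0_r. exact H1.
Qed.

(** * Analyticity along analytic arcs *)

Definition analytic0v (f : R -> R -> R2) : Prop :=
  analytic0 (fun u v => fst (f u v)) /\ analytic0 (fun u v => snd (f u v)).

Lemma analytic0v_comp (f : R -> R -> R2) (i : idx) :
  analytic0v f -> analytic0 (fun u v => comp (f u v) i).
Proof. intros [H1 H2]. now destruct i. Qed.

Lemma analytic0v_dot2 (f g : R -> R -> R2) :
  analytic0v f -> analytic0v g -> analytic0 (fun u v => dot2 (f u v) (g u v)).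
Proof. intros [] []. apply analytic0_plus; now apply analytic0_mult. Qed.

Lemma analytic0v_tangent (f : R -> R -> R2) (i : idx) :
  analytic0v f -> analytic0 (fun u v => comp (tangent (f u v)) i).
Proof. intros [H1 H2]. destruct i; simpl; trivial. now apply analytic0_opp. Qed.

(* Along a curve [r = e D] with [D] nonvanishing, the singular factor [r_i r_j / |r|^2] becomes
   the analytic [D_i D_j / |D|^2]. *)
Lemma radial_traction_an2 (lam mu : R) (N r D : R -> R -> R2) (e al be c0 c1 : R -> R -> R)
    (i j : idx) :
  analytic0v N -> analytic0v r -> analytic0v D -> D 0 0 <> (0, 0) ->
  near0 (fun u v => r u v = (e u v * fst (D u v), e u v * snd (D u v))) ->
  analytic0 al -> analytic0 be -> analytic0 c0 -> analytic0 c1 ->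
  analytic0 (fun u v => radial_traction lam mu (N u v) (r u v) (al u v) (be u v)
                    (c0 u v + c1 u v / dot2 (r u v) (r u v)) i j).
Proof.
  intros HN Hr HD HD0 E Hal Hbe H0 H1.
  assert (HDD : analytic0 (fun u v => dot2 (D u v) (D u v))) by now apply analytic0v_dot2.
  assert (Hpos : 0 < dot2 (D 0 0) (D 0 0)) by now apply dot2_pos.
  set (Q := fun u v => comp (D u v) i * comp (D u v) j * / dot2 (D u v) (D u v)).
  assert (HQ : analytic0 Q).
  { apply analytic0_mult; [apply analytic0_mult; now apply analytic0v_comp|].
    apply analytic0_inv; trivial. lra. }
  (* The coefficient c1 / |r|^2 enters in two places. In the [lam] term it meets |r|^2 and leaves
     [c1]; in the [mu] term it meets r_i r_j and leaves [c1] times [Q]. *)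
  apply analytic0_ext with (fun u v =>
    radial_traction lam mu (N u v) (r u v) (al u v) (be u v) (c0 u v) i j
    + - (4 * mu) * (c1 u v * dot2 (N u v) (r u v) * Q u v)
    + - (2 * lam) * (c1 u v * comp (N u v) i * comp (r u v) j)).
  - apply near0_impl with (2 := near0_and _ _ E (analytic0_near_neq0 _ HDD (Rgt_not_eq _ _ Hpos))).
    intros u v [Er Hp]. unfold Q, radial_traction. rewrite Er.
    assert (Hp' : 0 < dot2 (D u v) (D u v)).
    { replace (dot2 (D u v) (D u v))
        with (dot2 (D u v) (D u v) / dot2 (D 0 0) (D 0 0) * dot2 (D 0 0) (D 0 0)) by (field; lra).
      now apply Rmult_lt_0_compat. }
    clear - Hp'. destruct (D u v) as [d1 d2], (N u v) as [n1 n2].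
    generalize (e u v) (al u v) (be u v) (c0 u v) (c1 u v). intros e' al' be' c0' c1'.
    unfold dot2, tangent in *; simpl in *.
    (* Where [e'] vanishes so does r, and both sides are 0: the quotient by zero is multiplied by
       components of r. *)
    destruct (Req_dec e' 0) as [->|He].
    + destruct i, j; simpl; rewrite !Rmult_0_l; ring.
    + assert (e' * d1 * (e' * d1) + e' * d2 * (e' * d2) <> 0).
      { replace (e' * d1 * (e' * d1) + e' * d2 * (e' * d2))
          with (e' ^ 2 * (d1 * d1 + d2 * d2)) by ring.
        apply Rmult_integral_contrapositive_currified; [now apply pow_nonzero|lra]. }
      destruct i, j; simpl; field; repeat split; trivial; lra.
  - pose proof (analytic0v_dot2 N r HN Hr) as HNr. pose proof (analytic0v_dot2 r r Hr Hr) as Hrr.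
    pose proof (analytic0v_tangent N i HN) as Ht.
    pose proof (fun k => analytic0v_comp N k HN) as HNk.
    pose proof (fun k => analytic0v_comp r k Hr) as Hrk.
    destruct Hr as [Hr1 Hr2].
    unfold radial_traction, Rminus.
    repeat first [ eassumption | apply HNk | apply Hrk | apply analytic0_const | apply analytic0_plus
                 | apply analytic0_opp | apply analytic0_mult ].
Qed.

Ltac analytic0_tac :=
  repeat first [ eassumption | apply analytic0_const | apply analytic0_plus | apply analytic0_mult
               | apply analytic0_comp_entire ].

Lemma remainder_an2 (lam mu ks kp : R) (N r D : R -> R -> R2) (e : R -> R -> R) (i j : idx) :
  0 < ks -> 0 < kp -> analytic0v N -> analytic0v r -> analytic0v D -> D 0 0 <> (0, 0) ->
  near0 (fun u v => r u v = (e u v * fst (D u v), e u v * snd (D u v))) ->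
  analytic0 (fun u v => Re (remainder lam mu ks kp (N u v) (r u v) i j)) /\
  analytic0 (fun u v => Im (remainder lam mu ks kp (N u v) (r u v) i j)).
Proof.
  intros Hs Hp HN Hr HD HD0 E. pose proof (analytic0v_dot2 r r Hr Hr) as Hrr. split.
  - unfold remainder, Re, fst at 1.
    apply (radial_traction_an2 lam mu N r D e (fun u v => rem_al1 mu ks kp (dot2 (r u v) (r u v)))
      (fun u v => rem_be mu ks kp (dot2 (r u v) (r u v)))
      (fun u v => rem_be1_reg mu ks kp (dot2 (r u v) (r u v)))
      (fun u v => rem_be1_sing mu ks kp (dot2 (r u v) (r u v)))); trivial;
    unfold rem_al1, rem_be, rem_be1_reg, rem_be1_sing, Rdiv;
    analytic0_tac; apply entire_CV; entire_tac.
  (* The imaginary part has no singular coefficient and is brought to the common form with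
     [c1 = 0]. *)
  - apply analytic0_ext with (fun u v => radial_traction lam mu (N u v) (r u v)
      (im_al1 mu ks kp (dot2 (r u v) (r u v))) (im_be mu ks kp (dot2 (r u v) (r u v)))
      (im_be1 mu ks kp (dot2 (r u v) (r u v)) + 0 / dot2 (r u v) (r u v)) j i).
    + exists 1. split; [lra|]. intros u v _ _. unfold remainder, Im, snd at 1.
      f_equal. unfold Rdiv. ring.
    + apply (radial_traction_an2 lam mu N r D e (fun u v => im_al1 mu ks kp (dot2 (r u v) (r u v)))
        (fun u v => im_be mu ks kp (dot2 (r u v) (r u v)))
        (fun u v => im_be1 mu ks kp (dot2 (r u v) (r u v))) (fun _ _ => 0)); trivial;
      [| | |apply analytic0_const];
      unfold im_al1, im_be, im_be1, quartic2, quartic3, Rdiv; simpl pow; analytic0_tac;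
      apply entire_CV; entire_tac.
Qed.

(** * Analytic arcs and their unit normals *)

Lemma locally_R (x : R) (P : R -> Prop) :
  locally x P -> exists d, 0 < d /\ forall h, Rabs h < d -> P (x + h).
Proof.
  intros [d Hd]. exists d. split; [apply cond_pos|]. intros h Hh. apply Hd.
  change (Rabs (x + h - x) < d). now replace (x + h - x) with h by ring.
Qed.

Lemma R_locally (x : R) (P : R -> Prop) (d : R) :
  0 < d -> (forall h, Rabs h < d -> P (x + h)) -> locally x P.
Proof.
  intros Hd H. exists (mkposreal d Hd). intros y Hy. change (Rabs (y - x) < d) in Hy.
  replace y with (x + (y - x)) by ring. now apply H.
Qed.

Lemma analytic1_loc (f : R -> R) (t : R) :
  analytic1 f t -> exists a, Rbar_lt 0 (CV_radius a) /\
    locally t (fun s => f s = PSeries a (s - t)).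
Proof.
  intros [a [Ha H]]. exists a. split; trivial.
  destruct (locally_R 0 _ H) as [d [Hd Hf]]. apply R_locally with d; trivial.
  intros h Hh. specialize (Hf h Hh). rewrite Rplus_0_l in Hf. rewrite Hf. f_equal. ring.
Qed.

Lemma analytic1_smooth (f : R -> R) (t : R) (k : nat) : analytic1 f t -> ex_derive_n f k t.
Proof.
  intros H. destruct (analytic1_loc f t H) as [a [Ha E]].
  apply ex_derive_n_ext_loc with (fun s => PSeries a (s + - t)).
  - apply filter_imp with (2 := E). intros s Hs. now rewrite Hs.
  - apply ex_derive_n_comp_trans, ex_derive_n_PSeries.
    now rewrite Rplus_opp_r, Rabs_R0.
Qed.

Lemma ex_derive_n_shift (f : R -> R) (t s : R) (k : nat) :
  ex_derive_n f k (t + s) -> ex_derive_n (fun h => f (t + h)) k s.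
Proof.
  intros H. apply ex_derive_n_ext with (fun h => f (h + t)); [intros; f_equal; ring|].
  apply ex_derive_n_comp_trans. now rewrite Rplus_comm.
Qed.

Lemma Derive_shift (f : R -> R) (t s : R) : Derive (fun h => f (t + h)) s = Derive f (t + s).
Proof. unfold Derive. f_equal. apply Lim_ext. intros h. now rewrite Rplus_assoc. Qed.

Lemma velocity_shift (c : R -> R2) (t s : R) :
  velocity (fun h => c (t + h)) s = velocity c (t + s).
Proof.
  unfold velocity. f_equal;
  [apply (Derive_shift (fun s => fst (c s)))|apply (Derive_shift (fun s => snd (c s)))].
Qed.

(** A normal field is constrained only through the velocity at the centre of a chart. Recentring the
    arc at each of its points gives orthogonality along the whole arc; the smoothness required of a
    chart follows from analyticity. *)
Lemma smooth_chart_shift (Gam : R2 -> Prop) (p : R2) (c : R -> R2) (eps t : R) :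
  local_arc Gam p c eps -> analytic_regular c eps -> Rabs t < eps ->
  smooth_chart Gam (c t) (fun h => c (t + h)).
Proof.
  intros [He [_ [HG [Hinj Hloc]]]] Hreg Ht. exists (eps - Rabs t).
  assert (Hb : forall h, Rabs h < eps - Rabs t -> Rabs (t + h) < eps)
    by (intros h Hh; pose proof (Rabs_triang t h); lra).
  split; [split; [lra|split; [now rewrite Rplus_0_r|split; [|split]]]|].
  - intros h Hh. now apply HG, Hb.
  - intros h k Hh Hk E. apply Hinj in E; auto. lra.
  - intros t0 d Ht0 Hd.
    (* The second bound keeps the parameter found for the original arc inside the shorter interval
       around the new centre. *)
    assert (Hd' : 0 < Rmin d (eps - Rabs t - Rabs t0)) by (apply Rmin_glb_lt; lra).
    apply filter_imp with (2 := Hloc (t + t0) _ (Hb t0 Ht0) Hd').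
    intros x Hx Gx. destruct (Hx Gx) as [s [Hs1 [Hs2 Hs3]]].
    pose proof (Rmin_l d (eps - Rabs t - Rabs t0)). pose proof (Rmin_r d (eps - Rabs t - Rabs t0)).
    exists (s - t). split; [|split].
    + replace (s - t) with (s - (t + t0) + t0) by ring.
      pose proof (Rabs_triang (s - (t + t0)) t0). lra.
    + replace (s - t - t0) with (s - (t + t0)) by ring. lra.
    + rewrite Hs3. f_equal. ring.
  - intros s Hs. destruct (Hreg (t + s) (Hb s Hs)) as [A1 [A2 V]]. split.
    + intros k. split;
      [apply (ex_derive_n_shift (fun s => fst (c s)))|apply (ex_derive_n_shift (fun s => snd (c s)))];
      now apply analytic1_smooth.
    + now rewrite velocity_shift.
Qed.

(** [g] is the inner product of [n] with [w] turned by a right angle. As [n] is orthogonal to [w],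
    this is its only component, and the value of g^2 is Lagrange's identity for a unit vector
    [n]. *)
Lemma unit_orthogonal (n w : R2) :
  len2 n = 1 -> dot2 n w = 0 -> w <> (0, 0) ->
  let g := snd w * fst n - fst w * snd n in
  g ^ 2 = dot2 w w /\ fst n = g * snd w / dot2 w w /\ snd n = - (g * fst w) / dot2 w w.
Proof.
  intros Hn Hw Hnz g. pose proof (dot2_pos w Hnz) as Hp.
  assert (Hnn : dot2 n n = 1) by (rewrite <- len2_sqr, Hn; ring).
  subst g. destruct n as [n1 n2], w as [w1 w2]. unfold dot2 in *; simpl in *.
  split; [|split].
  - replace ((w2 * n1 - w1 * n2) * ((w2 * n1 - w1 * n2) * 1))
      with ((n1 * n1 + n2 * n2) * (w1 * w1 + w2 * w2) - (n1 * w1 + n2 * w2) ^ 2) by ring.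
    rewrite Hnn, Hw. ring.
  - apply Rmult_eq_reg_r with (w1 * w1 + w2 * w2); [|lra].
    unfold Rdiv. rewrite Rmult_assoc, Rinv_l by lra.
    replace (n1 * (w1 * w1 + w2 * w2))
      with ((w2 * n1 - w1 * n2) * w2 * 1 + w1 * (n1 * w1 + n2 * w2)) by ring.
    rewrite Hw. ring.
  - apply Rmult_eq_reg_r with (w1 * w1 + w2 * w2); [|lra].
    unfold Rdiv. rewrite Rmult_assoc, Rinv_l by lra.
    replace (n2 * (w1 * w1 + w2 * w2))
      with (- ((w2 * n1 - w1 * n2) * w1) * 1 + w2 * (n1 * w1 + n2 * w2)) by ring.
    rewrite Hw. ring.
Qed.

Lemma normal_along_arc (Gam : R2 -> Prop) (n : R2 -> R2) (p : R2) (c : R -> R2) (eps : R) :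
  unit_normal_field Gam nil n -> local_arc Gam p c eps -> analytic_regular c eps ->
  exists a b sg, Rbar_lt 0 (CV_radius a) /\ Rbar_lt 0 (CV_radius b) /\
    locally 0 (fun t => c t = (PSeries a t, PSeries b t)) /\
    (a 1%nat, b 1%nat) <> (0, 0) /\
    locally 0 (fun t => let w := (PSeries (PS_derive a) t, PSeries (PS_derive b) t) in
      n (c t) = (sg * snd w * / sqrt (dot2 w w), - (sg * fst w) * / sqrt (dot2 w w))).
Proof.
  intros Hn Harc Hreg. assert (He : 0 < eps) by apply Harc.
  assert (Hc0 : c 0 = p) by apply Harc.
  assert (Z : Rabs 0 < eps) by (rewrite Rabs_R0; lra).
  destruct (Hreg 0 Z) as [A1 [A2 V0]].
  destruct (analytic1_loc _ _ A1) as [a [Ha Ea]]. destruct (analytic1_loc _ _ A2) as [b [Hb Eb]].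
  exists a, b.
  assert (La : forall d : nat -> R, Rbar_lt 0 (CV_radius d) ->
     locally 0 (fun t => Rbar_lt (Rabs t) (CV_radius d))).
  { intros d Hd. destruct (CV_radius_bound d Hd) as [r [M [Hr HM]]].
    apply R_locally with r; trivial. intros h Hh. rewrite Rplus_0_l.
    now apply (CV_radius_lower d r M). }
  assert (Dv : forall (f : R -> R) (d : nat -> R), Rbar_lt 0 (CV_radius d) ->
     locally 0 (fun s => f s = PSeries d (s - 0)) ->
     locally 0 (fun s => Derive f s = PSeries (PS_derive d) s)).
  { intros f d Hd E. pose proof (locally_locally _ _ E) as E2.
    apply filter_imp with (2 := filter_and _ _ E2 (La d Hd)). intros s [Hs Hs2].
    rewrite (Derive_ext_loc _ (PSeries d)); [now apply Derive_PSeries|].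
    apply filter_imp with (2 := Hs). intros t Ht. now rewrite Ht, Rminus_0_r. }
  set (w := fun t => (PSeries (PS_derive a) t, PSeries (PS_derive b) t)).
  assert (Vw : locally 0 (fun t => velocity c t = w t)).
  { apply filter_imp with (2 := filter_and _ _ (Dv _ a Ha Ea) (Dv _ b Hb Eb)).
    intros t [H1 H2]. unfold velocity, w. f_equal; assumption. }
  assert (Ec : locally 0 (fun t => c t = (PSeries a t, PSeries b t))).
  { apply filter_imp with (2 := filter_and _ _ Ea Eb). intros t [H1 H2].
    rewrite (surjective_pairing (c t)), H1, H2. now rewrite Rminus_0_r. }
  assert (Gc : locally 0 (fun t => Gam (c t) /\ velocity c t <> (0, 0)
             /\ len2 (n (c t)) = 1 /\ dot2 (n (c t)) (velocity c t) = 0)).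
  { apply R_locally with eps; trivial. intros h Hh. rewrite Rplus_0_l.
    assert (G : Gam (c h)) by now apply Harc.
    destruct (Hn (c h) G (fun F => F)) as [H1 [H2 _]].
    repeat split; trivial; [apply (Hreg h Hh)|].
    rewrite <- (H2 _ (smooth_chart_shift Gam p c eps h Harc Hreg Hh)).
    now rewrite velocity_shift, Rplus_0_r. }
  assert (w0 : w 0 = (a 1%nat, b 1%nat)).
  { unfold w. rewrite !PSeries_0. unfold PS_derive. simpl. f_equal; ring. }
  assert (Vz : velocity c 0 = w 0) by exact (locally_singleton _ _ Vw).
  (* By [unit_orthogonal], g^2 = |w|^2, so g differs from the square root of |w|^2 only by a sign.
     Continuity of the normal field is used to keep this sign fixed near 0. *)
  set (g := fun t => snd (w t) * fst (n (c t)) - fst (w t) * snd (n (c t))).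
  assert (Cw : forall d : nat -> R, Rbar_lt 0 (CV_radius d) -> continuous (PSeries d) 0).
  { intros d Hd. apply continuity_pt_filterlim, PSeries_continuity. now rewrite Rabs_R0. }
  (* The field is continuous only relative to the curve; this is enough because [c] stays on the
     curve near 0. *)
  assert (Cn : filterlim (fun t => n (c t)) (locally 0) (locally (n (c 0)))).
  { apply filterlim_comp with (within (fun x => Gam x /\ ~ In x nil) (locally (c 0))).
    - intros P HP. unfold within in HP.
      assert (Hcc : filterlim c (locally 0) (locally (c 0))).
      { rewrite (locally_singleton _ _ Ec).
        apply filterlim_ext_loc with (fun t => (PSeries a t, PSeries b t)).
        - apply filter_imp with (2 := Ec). now intros.
        - apply filterlim_locally. intros d.
          pose proof (proj1 (filterlim_locally _ _) (Cw a Ha) d) as B1.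
          pose proof (proj1 (filterlim_locally _ _) (Cw b Hb) d) as B2.
          exact (filter_and _ _ B1 B2). }
      specialize (Hcc _ HP). unfold filtermap in *.
      apply filter_imp with (2 := filter_and _ _ Hcc Gc). intros t [H1 H2].
      apply H1. split; [apply H2|intros []].
    - apply (Hn (c 0)); [|intros []]. now apply Harc. }
  assert (Cg : continuous g 0).
  { unfold g. apply (continuous_minus (fun t => snd (w t) * fst (n (c t)))
      (fun t => fst (w t) * snd (n (c t)))); apply @continuous_mult.
    - apply Cw. now rewrite CV_radius_derive.
    - apply filterlim_comp with (1 := Cn). apply continuous_fst.
    - apply Cw. now rewrite CV_radius_derive.
    - apply filterlim_comp with (1 := Cn). apply continuous_snd. }
  assert (Hg : locally 0 (fun t => g t ^ 2 = dot2 (w t) (w t) /\ 0 < dot2 (w t) (w t) /\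
     fst (n (c t)) = g t * snd (w t) / dot2 (w t) (w t) /\
     snd (n (c t)) = - (g t * fst (w t)) / dot2 (w t) (w t))).
  { apply filter_imp with (2 := filter_and _ _ Vw Gc).
    intros t [H1 [H2 [H3 [H4 H5]]]]. rewrite H1 in H3, H5.
    destruct (unit_orthogonal (n (c t)) (w t) H4 H5 H3) as [K1 [K2 K3]].
    repeat split; trivial. now apply dot2_pos. }
  assert (Hg0 := locally_singleton _ _ Hg). cbv beta in Hg0.
  destruct Hg0 as [G1 [G2 _]].
  assert (Gnz : g 0 <> 0) by (intros Eg; rewrite Eg in G1; simpl in G1; lra).
  assert (Sg : exists sg, sg ^ 2 = 1 /\ locally 0 (fun t => 0 < sg * g t)).
  { destruct (Rtotal_order (g 0) 0) as [Hlt|[Heq|Hgt]]; [|contradiction|].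
    - exists (-1). split; [ring|].
      apply filter_imp with (fun t => g t < 0); [intros; lra|].
      exact (Cg _ (open_lt 0 (g 0) Hlt)).
    - exists 1. split; [ring|].
      apply filter_imp with (fun t => 0 < g t); [intros; lra|].
      exact (Cg _ (open_gt 0 (g 0) Hgt)). }
  destruct Sg as [sg [Hsg1 Hsg2]]. exists sg. repeat split; trivial.
  - rewrite <- w0, <- Vz. exact V0.
  - apply filter_imp with (2 := filter_and _ _ Hg Hsg2).
    intros t [[K1 [K2 [K3 K4]]] K5]. fold (w t). cbv zeta.
    assert (Es : sqrt (dot2 (w t) (w t)) = sg * g t).
    { rewrite <- K1. replace (g t ^ 2) with ((sg * g t) * (sg * g t)).
      - apply sqrt_square. lra.
      - replace (sg * g t * (sg * g t)) with (sg ^ 2 * g t ^ 2) by ring. rewrite Hsg1. ring. }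
    rewrite Es. rewrite (surjective_pairing (n (c t))), K3, K4, <- K1.
    assert (g t <> 0) by (intros Eg; rewrite Eg in K5; lra).
    assert (sg <> 0) by (intros Eg; rewrite Eg in K5; lra).
    f_equal; field; split; trivial.
Qed.

Lemma analytic0_normal (a b : nat -> R) (sg : R) :
  Rbar_lt 0 (CV_radius a) -> Rbar_lt 0 (CV_radius b) -> (a 1%nat, b 1%nat) <> (0, 0) ->
  analytic0v (fun _ v => let w := (PSeries (PS_derive a) v, PSeries (PS_derive b) v) in
    (sg * snd w * / sqrt (dot2 w w), - (sg * fst w) * / sqrt (dot2 w w))).
Proof.
  intros Ha Hb Hab.
  assert (Wa : analytic0 (fun _ v => PSeries (PS_derive a) v))
    by (apply analytic0_snd; now rewrite CV_radius_derive).
  assert (Wb : analytic0 (fun _ v => PSeries (PS_derive b) v))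
    by (apply analytic0_snd; now rewrite CV_radius_derive).
  assert (Ws : analytic0 (fun _ v => / sqrt (dot2 (PSeries (PS_derive a) v, PSeries (PS_derive b) v)
                                       (PSeries (PS_derive a) v, PSeries (PS_derive b) v)))).
  { apply (analytic0_inv_sqrt (fun _ v => dot2 (PSeries (PS_derive a) v, PSeries (PS_derive b) v)
                                   (PSeries (PS_derive a) v, PSeries (PS_derive b) v))).
    - unfold dot2; simpl. analytic0_tac.
    - rewrite !PSeries_0. apply dot2_pos. unfold PS_derive. simpl. now rewrite !Rmult_1_l. }
  split; cbv zeta; unfold fst, snd.
  - apply analytic0_mult; [|exact Ws]. analytic0_tac.
  - apply analytic0_mult; [|exact Ws]. apply analytic0_opp. analytic0_tac.
Qed.

Lemma near0_fst (P : R -> Prop) : locally 0 P -> near0 (fun u _ => P u).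
Proof.
  intros H. destruct (locally_R 0 P H) as [d [Hd K]]. exists d. split; trivial.
  intros u v Hu _. rewrite <- (Rplus_0_l u). now apply K.
Qed.

Lemma near0_snd (P : R -> Prop) : locally 0 P -> near0 (fun _ v => P v).
Proof.
  intros H. destruct (locally_R 0 P H) as [d [Hd K]]. exists d. split; trivial.
  intros u v _ Hv. rewrite <- (Rplus_0_l v). now apply K.
Qed.

Lemma remainder_on_charts (lam mu ks kp : R) (Gam : R2 -> Prop) (n : R2 -> R2)
    (chart : R2 -> R -> R2) (p q : R2) (i j : idx) :
  0 < ks -> 0 < kp -> unit_normal_field Gam nil n -> analytic_atlas Gam chart ->
  Gam p -> Gam q ->
  let RD := fun u v => remainder lam mu ks kp (n (chart q v)) (sub2 (chart p u) (chart q v)) i j in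
  analytic0 (fun u v => Re (RD u v)) /\ analytic0 (fun u v => Im (RD u v)).
Proof.
  intros Hs Hp Hn Hat Gp Gq RD.
  destruct (Hat p Gp) as [eps [Harc Hreg]]. destruct (Hat q Gq) as [eps' [Harc' Hreg']].
  destruct (normal_along_arc Gam n p _ eps Hn Harc Hreg) as [a [b [_ [Ha [Hb [Ec [Hab _]]]]]]].
  destruct (normal_along_arc Gam n q _ eps' Hn Harc' Hreg')
    as [a' [b' [sg [Ha' [Hb' [Ec' [Hab' En]]]]]]].
  set (N := fun (_ v : R) => let w := (PSeries (PS_derive a') v, PSeries (PS_derive b') v) in
      (sg * snd w * / sqrt (dot2 w w), - (sg * fst w) * / sqrt (dot2 w w))).
  assert (HN : analytic0v N) by now apply analytic0_normal.
  set (r := fun u v => sub2 (PSeries a u, PSeries b u) (PSeries a' v, PSeries b' v)).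
  assert (Hr : analytic0v r).
  { split; unfold r, sub2; simpl; apply analytic0_minus;
    (now apply analytic0_fst) || now apply analytic0_snd. }
  assert (E : near0 (fun u v => n (chart q v) = N u v /\ sub2 (chart p u) (chart q v) = r u v)).
  { apply near0_impl with (2 := near0_and _ _ (near0_fst _ Ec)
      (near0_and _ _ (near0_snd _ Ec') (near0_snd _ En))).
    intros u v [H1 [H2 H3]]. split; [exact H3|]. unfold r. now rewrite H1, H2. }
  assert (HD : exists D e, analytic0v D /\ D 0 0 <> (0, 0) /\
     near0 (fun u v => r u v = (e u v * fst (D u v), e u v * snd (D u v)))).
  { assert (Dec : p = q \/ p <> q).
    { destruct p as [p1 p2], q as [q1 q2].
      destruct (Req_dec p1 q1) as [->|]; [|right; congruence].
      destruct (Req_dec p2 q2) as [->|]; [left; trivial|right; congruence]. }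
    destruct Dec as [Epq|Hpq].
    - subst q.
      destruct (analytic0_diff_quotient a Ha) as [Da [HDa [Da0 Qa]]].
      destruct (analytic0_diff_quotient b Hb) as [Db [HDb [Db0 Qb]]].
      (* At the origin D is the velocity of the arc, which is nonzero by regularity. *)
      exists (fun u v => (Da u v, Db u v)), (fun u v => u - v). split; [split; assumption|].
      split; [now rewrite Da0, Db0|].
      (* The same arc has been expanded twice, with coefficients [a], [b] and [a'], [b']. Both
         expansions represent the chart near 0, so their values agree there and the difference
         quotients of [a] and [b] apply. *)
      apply near0_impl with (2 := near0_and _ _ (near0_snd _ Ec)
        (near0_and _ _ (near0_snd _ Ec') (near0_and _ _ Qa Qb))).
      intros u v [H1 [H2 [H3 H4]]]. rewrite H1 in H2. injection H2 as H5 H6.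
      unfold r, sub2. simpl. now rewrite H3, H4, H5, H6.
    - exists r, (fun _ _ => 1). split; [exact Hr|split].
      + destruct (near0_at _ E) as [_ <-]. apply sub2_neq.
        (* For distinct base points r is itself nonzero at the origin, so D = r with e = 1. *)
        destruct Harc as [_ [-> _]]. destruct Harc' as [_ [-> _]]. exact Hpq.
      + exists 1. split; [lra|]. intros u v _ _.
        rewrite !Rmult_1_l. apply surjective_pairing. }
  destruct HD as [D [e [HD [HD0 De]]]].
  destruct (remainder_an2 lam mu ks kp N r D e i j Hs Hp HN Hr HD HD0 De) as [K1 K2].
  split; [apply analytic0_ext with (2 := K1)|apply analytic0_ext with (2 := K2)];
  apply near0_impl with (2 := E); intros u v [H1 H2]; unfold RD; now rewrite H1, H2.
Qed.

Lemma analytic2_0 (f : R -> R -> R) : analytic0 f -> analytic2 f 0 0.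
Proof.
  intros H. apply analytic0_analytic2. apply analytic0_ext with (2 := H).
  exists 1. split; [lra|]. intros u v _ _. now rewrite !Rplus_0_l.
Qed.

Theorem theorem3p6 (lam mu rho omega : R)
    (Omega : R2 -> Prop) (corners : list R2) (n : R2 -> R2)
    (hmu : 0 < mu) (hlam : 0 < lam + mu) (hrho : 0 < rho) (homega : 0 < omega)
    (hOmega : is_domain Omega)
    (hbounded : bounded2 Omega \/ bounded2 (complement (closure2 Omega)))
    (hGam : piecewise_smooth (boundary Omega) corners)
    (hn : unit_normal_field (boundary Omega) corners n) :
  (forall x y : R2, boundary Omega x -> boundary Omega y -> ~ In y corners ->
     x <> y -> forall i j : idx,
     traction_y lam mu (n y) (green_lame lam mu) x y i j
     = RtoC (traction_lame_formula lam mu (n y) x y i j))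
  /\
  exists RD : R2 -> R2 -> idx -> idx -> C,
    (forall x y : R2, boundary Omega x -> boundary Omega y ->
       ~ In y corners -> x <> y -> forall i j : idx,
       kernel_D lam mu rho omega n x y i j
       = (traction_y lam mu (n y) (green_lame lam mu) x y j i
          + RtoC (ln (len2 (sub2 x y))) * RtoC (kernel_F lam mu rho omega n x y i j)
          + RD x y i j)%C)
    /\
    (forall y : R2, boundary Omega y -> ~ In y corners -> forall i j : idx,
       filterlim (fun x => RD x y i j)
         (within (fun x => boundary Omega x /\ x <> y) (locally y))
         (locally (RtoC 0)))
    /\
    (corners = nil ->
     forall chart : R2 -> R -> R2, analytic_atlas (boundary Omega) chart ->
       forall i j : idx,
       analytic_kernel (boundary Omega) chart
         (fun x y => kernel_F lam mu rho omega n x y i j)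
       /\ analytic_kernel (boundary Omega) chart
            (fun x y => Re (RD x y i j))
       /\ analytic_kernel (boundary Omega) chart
            (fun x y => Im (RD x y i j))).
Proof.
  set (ks := wave_s mu rho omega). set (kp := wave_p lam mu rho omega).
  destruct (wave_numbers lam mu rho omega) as [Hs [Hp _]]; trivial. fold ks in Hs. fold kp in Hp.
  (* This formula is defined for all pairs of points, so it also serves as its own extension to the
     diagonal in the analyticity claims. *)
  set (RD := fun x y i j => remainder lam mu ks kp (n y) (sub2 x y) i j).
  split; [intros; now apply traction_y_lame_formula|]. exists RD. split; [|split].
  - intros x y _ _ _ Hxy i j.
    pose proof (Re_traction_navier lam mu rho omega (n y) x y j i hmu hlam hrho homega Hxy) as HR.
    pose proof (Im_traction_navier lam mu rho omega (n y) x y j i hmu hlam hrho homega Hxy) as HI.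
    cbv zeta in HR, HI. fold ks kp in HR, HI.
    pose proof (traction_y_lame_formula lam mu (n y) x y j i hmu hlam Hxy) as HE.
    unfold kernel_D, kernel_F.
    (* With the Lame traction written as a real number, the imaginary part of the identity concerns
       [RD] alone. *)
    rewrite HE in HR |- *.
    rewrite (surjective_pairing (traction_y lam mu (n y) (green_navier lam mu rho omega) x y j i)).
    unfold Re in HR. rewrite HR.
    fold (Im (traction_y lam mu (n y) (green_navier lam mu rho omega) x y j i)).
    unfold RD, remainder. cbv zeta. rewrite <- HI.
    generalize (Im (traction_y lam mu (n y) (green_navier lam mu rho omega) x y j i)). intros q.
    unfold Cplus, Cmult, RtoC, Im. simpl. f_equal; ring.
  - intros y _ _ i j. apply remainder_vanishes; trivial. now intros x [_ H].
  - intros -> chart Hat i j.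
    assert (K : forall p q, boundary Omega p -> boundary Omega q ->
       analytic0 (fun u v => Re (RD (chart p u) (chart q v) i j)) /\
       analytic0 (fun u v => Im (RD (chart p u) (chart q v) i j))).
    { intros p q Gp Gq. now apply remainder_on_charts with (boundary Omega). }
    split; [|split].
    (* Off the diagonal the imaginary part of [RD] is that of the traction of G, so this multiple
       extends F. *)
    + exists (fun x y => - (2 / PI) * Im (RD x y i j)). split.
      * intros x y _ _ Hxy. unfold kernel_F. now rewrite Im_traction_navier.
      * intros p q Gp Gq. apply analytic2_0, analytic0_mult; [apply analytic0_const|now apply K].
    + exists (fun x y => Re (RD x y i j)). split; trivial.
      intros p q Gp Gq. apply analytic2_0. now apply K.
    + exists (fun x y => Im (RD x y i j)). split; trivial.
      intros p q Gp Gq. apply analytic2_0. now apply K.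
Qed.
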